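(* There exists $c>0$, and for every $\varepsilon\in(0,1/2)$ there exists $c_1>0$, such that the following holds for every sufficiently large $n$. Let $G$ be a graph on $n$ vertices of average degree $d\geq 1$. Then $$\mathrm{disc}^{+}(G)> \begin{cases} c\,d^{1/2}n &\text{if } d\leq n^{2/3},\\ c\, n^2/d & \text{if } n^{2/3}\leq d\leq n^{4/5},\\ c_1\,d^{1/4}n/\log n & \text{if } n^{4/5}\leq d\leq (1/2-\varepsilon)n.\end{cases}$$
   Context: For a graph $G$ with $n$ vertices and $m$ edges, its density is $p=m/\binom{n}{2}$ and its average degree is $d=2m/n$. For $U\subseteq V(G)$, $e(U)$ denotes the number of edges of the induced subgraph $G[U]$ and $\mathrm{disc}(U)=e(U)-p\binom{|U|}{2}$. The positive discrepancy is $\mathrm{disc}^{+}(G)=\max_{U\subseteq V(G)}\mathrm{disc}(U)$. *)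

(* Defs.v *)
From HB Require Import structures.
From mathcomp Require Import all_boot all_order all_algebra.
From mathcomp Require Import all_reals.

Set Implicit Arguments.
Unset Strict Implicit.
Unset Printing Implicit Defensive.

Import Order.TTheory GRing.Theory Num.Theory.

Local Open Scope ring_scope.

Record sgraph (T : finType) := SGraph {
  adj :> rel T;
  adj_sym : symmetric adj;
  adj_irrefl : irreflexive adj
}.

Definition edge_set (T : finType) (G : sgraph T) : {set {set T}} :=
  [set [set p.1; p.2] | p : T * T & G p.1 p.2].

Definition edges_in (T : finType) (G : sgraph T) (U : {set T}) : nat :=
  #|[set f in edge_set G | f \subset U]|.

Definition density (R : realType) (T : finType) (G : sgraph T) : R :=
  #|edge_set G|%:R / 'C(#|T|, 2)%:R.

Definition avg_degree (R : realType) (T : finType) (G : sgraph T) : R :=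
  2 * #|edge_set G|%:R / #|T|%:R.

Definition disc (R : realType) (T : finType) (G : sgraph T) (U : {set T}) : R :=
  (edges_in G U)%:R - density R G * 'C(#|U|, 2)%:R.

(* Seeding the iterated maximum with the value at the empty set makes it the
   maximum of disc over all subsets, with no spurious default value. *)
Definition pos_disc (R : realType) (T : finType) (G : sgraph T) : R :=
  \big[Num.max/disc R G set0]_(U : {set T}) disc R G U.

(* Main.v *)
(** Write [M = A - p (J - I)].  Since the entries of [M] sum to 0, the parallelogram
   identity turns any [x] in [[-1, 1]^V] into a set [U] with
   [x^T M x <= 8 disc^+(G)], so it suffices to make [x^T M x] large.

   For [d <= n^(4/5)], restrict to the vertices of degree O(d) (if they span few edges, a
   two-valued [x] already gains a constant fraction of [n d]), take independent random
   signs [g] and put [x_v = (g_v + clip (th * \sum_(u ~ v) g_u)) / 2].  Adjacent vertices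
   have correlation at least of order [th], while by Harris' inequality and a martingale
   bound the remaining correlations lie between 0 and [th^2] times the codegree.  Hence
   [E x^T M x] is of order [th n d - th^2 d^3], and [th ~ min (d^(-1/2), n / d^2)] is optimal.

   For dense graphs, let [s n] be the supremum of [<M, X>] over positive semidefinite [X]
   with diagonal at most 1; rounding truncated random sign sums shows
   [s n = O (log n) disc^+(G)].  Duality provides a diagonal [W] of trace O(s n) such that
   [N = W - M] is positive semidefinite.  By Schur's product theorem the entrywise square
   of [N], restricted to the set [U] of vertices with [W_i = O(s)], is an admissible test
   matrix after division by O(s^2), whence [\sum_(i, j in U) M_ij^3 = O (s^3 n)].  As
   [U] misses few vertices and [p < 1/2], the left side is of order [n d], so that
   [s] is at least of order [d^(1/3)], which exceeds [d^(1/4)]. *)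
Require Import Defs.
From mathcomp Require Import all_boot all_order all_algebra.
From mathcomp Require Import all_reals sequences exp.
From mathcomp Require Import ring lra.

Import Order.TTheory GRing.Theory Num.Theory.

Set Implicit Arguments.
Unset Strict Implicit.
Unset Printing Implicit Defensive.

Local Open Scope ring_scope.

(** * Averages over random signs *)

Section Clip.
Variable R : realType.
Implicit Types x y b : R.

Definition clip x : R := if x <= -1 then -1 else if 1 <= x then 1 else x.

Definition mono_lip (f : R -> R) := forall x y, x <= y -> 0 <= f y - f x <= y - x.

Lemma clip_mono_lip : mono_lip clip.
Proof.
move=> x y; rewrite /clip.
by case: (leP x (-1)); case: (leP y (-1)); case: (leP 1 x); case: (leP 1 y) => *;
  apply/andP; split; lra.
Qed.

Lemma clipN x : clip (- x) = - clip x.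
Proof.
rewrite /clip; case: (leP x (-1)); case: (leP (- x) (-1)); case: (leP 1 x);
  case: (leP 1 (- x)) => *; lra.
Qed.

Lemma clip_itv x : -1 <= clip x <= 1.
Proof. by rewrite /clip; case: (leP x (-1)); case: (leP 1 x) => *; apply/andP; split; lra. Qed.

(** For |x| <= 1/2 both points lie where [clip] is the identity; otherwise the left side is
    nonpositive and monotonicity suffices. The quadratic factor stands in for an indicator because
    its average over signs is a variance. *)
Lemma clip_central_diff x b : 0 <= b -> b <= 1 / 2 ->
  2 * b * (1 - 4 * x ^+ 2) <= clip (x + b) - clip (x - b).
Proof.
move=> b0 b1; have [x1|x1] := leP (x ^+ 2) (1 / 4).
  have : clip (x + b) - clip (x - b) = 2 * b.
    have h1 : x <= 1 / 2 by nra.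
    have h2 : - (1 / 2) <= x by nra.
    rewrite /clip; case: (leP (x + b) (-1)); case: (leP (x - b) (-1)); case: (leP 1 (x + b));
      case: (leP 1 (x - b)) => *; lra.
  by move=> ->; nra.
have h : x - b <= x + b by lra.
have /andP[h0 _] := clip_mono_lip h.
by apply: le_trans h0; nra.
Qed.

(** The difference splits as (x - clip x) y + (y - clip y) clip x, and weighted AM-GM applies to
    each product. A large [l] puts the weight on the truncation errors, whose averages are tiny. *)
Lemma clip_prod_err x y (l : R) : 0 < l ->
  x * y - clip x * clip y <= l / 2 * ((x - clip x) ^+ 2 + (y - clip y) ^+ 2)
     + (x ^+ 2 + y ^+ 2) / (2 * l) /\
  - (x * y - clip x * clip y) <= l / 2 * ((x - clip x) ^+ 2 + (y - clip y) ^+ 2)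
     + (x ^+ 2 + y ^+ 2) / (2 * l).
Proof.
move=> l0.
have hx : clip x ^+ 2 <= x ^+ 2.
  by rewrite /clip; case: (leP x (-1)); case: (leP 1 x) => *; nra.
set c := clip x in hx *; set e := clip y.
have key (u v : R) : u * v <= l / 2 * u ^+ 2 + v ^+ 2 / (2 * l) /\
    - (u * v) <= l / 2 * u ^+ 2 + v ^+ 2 / (2 * l).
  have p1 : l / 2 * u ^+ 2 + v ^+ 2 / (2 * l) - u * v = (l * u - v) ^+ 2 / (2 * l) by field; lra.
  have p2 : l / 2 * u ^+ 2 + v ^+ 2 / (2 * l) + u * v = (l * u + v) ^+ 2 / (2 * l) by field; lra.
  have q1 : 0 <= (l * u - v) ^+ 2 / (2 * l) by apply: divr_ge0; [exact: sqr_ge0|lra].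
  have q2 : 0 <= (l * u + v) ^+ 2 / (2 * l) by apply: divr_ge0; [exact: sqr_ge0|lra].
  by split; lra.
have [k1 k2] := key (x - c) y; have [k3 k4] := key (y - e) c.
have h : c ^+ 2 / (2 * l) <= x ^+ 2 / (2 * l) by rewrite ler_pM2r // invr_gt0; lra.
have -> : x * y - c * e = (x - c) * y + (y - e) * c by ring.
by rewrite mulrDl; split; lra.
Qed.
End Clip.

Section SignAverage.
Variables (R : realType) (J : Type).
Implicit Types (s : seq (J -> R)) (z : J -> R) (F : (J -> R) -> R).

(* The expectation of [F (z + \sum_(a <- s) g_a a)] over independent uniform signs [g_a]. *)
Fixpoint sign_avg s F z : R :=
  if s is a :: s' then
    (sign_avg s' F (fun j => z j + a j) + sign_avg s' F (fun j => z j - a j)) / 2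
  else F z.

Lemma le_sign_avg s F1 F2 z : (forall y, F1 y <= F2 y) -> sign_avg s F1 z <= sign_avg s F2 z.
Proof.
move=> le12; elim: s z => [|a s IH] z //=.
by have := IH (fun j => z j + a j); have := IH (fun j => z j - a j); lra.
Qed.

Lemma eq_sign_avg s F1 F2 z : (forall y, F1 y = F2 y) -> sign_avg s F1 z = sign_avg s F2 z.
Proof. by move=> e; elim: s z => [|a s IH] z //=; rewrite !IH. Qed.

Lemma sign_avgD s F1 F2 z :
  sign_avg s (fun y => F1 y + F2 y) z = sign_avg s F1 z + sign_avg s F2 z.
Proof. by elim: s z => [|a s IH] z //=; rewrite !IH; lra. Qed.

Lemma sign_avgZ s F (c : R) z : sign_avg s (fun y => c * F y) z = c * sign_avg s F z.
Proof. by elim: s z => [|a s IH] z //=; rewrite !IH; lra. Qed.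

Lemma sign_avg_sum s (I : Type) (r : seq I) (P : pred I) (F : I -> (J -> R) -> R) z :
  sign_avg s (fun y => \sum_(i <- r | P i) F i y) z = \sum_(i <- r | P i) sign_avg s (F i) z.
Proof.
elim: s z => [|a s IH] z //=.
by rewrite !IH -big_split /= mulr_suml.
Qed.

(** [y] is one outcome of the signs; the box around [z] later bounds the coordinates that are not
    clipped. *)
Lemma sign_avg_attained s F z : exists2 y, sign_avg s F z <= F y
  & forall i, z i - \sum_(a <- s) `|a i| <= y i <= z i + \sum_(a <- s) `|a i|.
Proof.
elim: s z => [|a s IH] z /=; first by exists z => // i; rewrite big_nil subr0 addr0 lexx.
have [y1 h1 b1] := IH (fun j => z j + a j); have [y2 h2 b2] := IH (fun j => z j - a j).
have na i : - `|a i| <= a i <= `|a i| by rewrite -ler_norml.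
have [h|h] := leP (F y1) (F y2); [exists y2|exists y1]; try lra; move=> i; rewrite big_cons.
  by have /andP[] := na i; have /andP[] := b2 i => *; apply/andP; split; lra.
by have /andP[] := na i; have /andP[] := b1 i => *; apply/andP; split; lra.
Qed.

Lemma sign_avg_moment2 s i j z :
  sign_avg s (fun y => y i * y j) z = z i * z j + \sum_(a <- s) a i * a j.
Proof.
elim: s z => [|a s IH] z /=; first by rewrite big_nil addr0.
by rewrite !IH big_cons; lra.
Qed.

Lemma sign_avg_mono_lip s (f : R -> R) i z1 z2 : mono_lip f -> z1 i <= z2 i ->
  0 <= sign_avg s (fun y => f (y i)) z2 - sign_avg s (fun y => f (y i)) z1 <= z2 i - z1 i.
Proof.
move=> fP; elim: s z1 z2 => [|a s IH] z1 z2 z12 /=; first exact: fP.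
have /andP[h1 h2] : 0 <= sign_avg s (fun y => f (y i)) (fun j => z2 j + a j)
   - sign_avg s (fun y => f (y i)) (fun j => z1 j + a j) <= (z2 i + a i) - (z1 i + a i).
  by apply: IH; lra.
have /andP[h3 h4] : 0 <= sign_avg s (fun y => f (y i)) (fun j => z2 j - a j)
   - sign_avg s (fun y => f (y i)) (fun j => z1 j - a j) <= (z2 i - a i) - (z1 i - a i).
  by apply: IH; lra.
by apply/andP; split; lra.
Qed.

Lemma sign_avg_odd s (f : R -> R) i z1 z2 : (forall x, f (- x) = - f x) -> z1 i = - z2 i ->
  sign_avg s (fun y => f (y i)) z1 = - sign_avg s (fun y => f (y i)) z2.
Proof.
move=> fN; elim: s z1 z2 => [|a s IH] z1 z2 z12 /=; first by rewrite z12 fN.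
rewrite (IH (fun j => z1 j + a j) (fun j => z2 j - a j)); last by rewrite z12; ring.
rewrite (IH (fun j => z1 j - a j) (fun j => z2 j + a j)); last by rewrite z12; ring.
by ring.
Qed.

Lemma sign_avg_odd0 s (f : R -> R) i : (forall x, f (- x) = - f x) ->
  sign_avg s (fun y => f (y i)) (fun=> 0) = 0.
Proof.
move=> fN; have := @sign_avg_odd s f i (fun=> 0) (fun=> 0) fN.
by rewrite oppr0 => /(_ erefl); lra.
Qed.

(* Harris' inequality together with the matching Lipschitz bound: each sign
   contributes [(f-increment) * (g-increment) / 4] to the covariance. *)
Lemma sign_avg_cov s (f g : R -> R) i j z : mono_lip f -> mono_lip g ->
  all (fun a : J -> R => (0 <= a i) && (0 <= a j)) s ->
  0 <= sign_avg s (fun y => f (y i) * g (y j)) z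
        - sign_avg s (fun y => f (y i)) z * sign_avg s (fun y => g (y j)) z
    <= \sum_(a <- s) a i * a j.
Proof.
move=> fP gP; elim: s z => [|a s IH] z /=.
  by move=> _; rewrite big_nil subrr lexx.
case/andP=> /andP[ai aj] as0; rewrite big_cons.
have /andP[h1 h2] := IH (fun j => z j + a j) as0.
have /andP[h3 h4] := IH (fun j => z j - a j) as0.
have aij (x y : R) : 0 <= y -> x - y <= x + y by lra.
have /andP[h5 h6] := @sign_avg_mono_lip s f i (fun j => z j - a j) (fun j => z j + a j)
  fP (aij _ _ ai).
have /andP[h7 h8] := @sign_avg_mono_lip s g j (fun j => z j - a j) (fun j => z j + a j)
  gP (aij _ _ aj).
move: h1 h2 h3 h4 h5 h6 h7 h8.
set f1 := sign_avg s (fun y => f (y i)) _; set f2 := sign_avg s (fun y => f (y i)) _.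
set g1 := sign_avg s (fun y => g (y j)) _; set g2 := sign_avg s (fun y => g (y j)) _.
set k1 := sign_avg s (fun y => f (y i) * g (y j)) _.
set k2 := sign_avg s (fun y => f (y i) * g (y j)) _.
set S := \sum_(_ <- _) _ => h1 h2 h3 h4 h5 h6 h7 h8.
have e : (k1 + k2) / 2 - (f1 + f2) / 2 * ((g1 + g2) / 2) =
  ((k1 - f1 * g1) + (k2 - f2 * g2)) / 2 + (f1 - f2) * (g1 - g2) / 4 by field.
rewrite e.
have p1 : 0 <= (f1 - f2) * (g1 - g2) by apply: mulr_ge0.
have p2 : (f1 - f2) * (g1 - g2) <= (2 * a i) * (2 * a j) by apply: ler_pM => //; lra.
by apply/andP; split; lra.
Qed.

(** Averaging out one sign adds to the covariance [a i / 2] times the change it causes in the mean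
    of [clip]. [clip_central_diff] bounds this change from below, its square averaging to [z j ^+ 2]
    plus the remaining variance. *)
Lemma sign_avg_clip_lower s i j z :
  all (fun a : J -> R => (0 <= a i) && (0 <= a j <= 1 / 2)) s ->
  z i * sign_avg s (fun y => clip (y j)) z
   + (\sum_(a <- s) a i * a j) * (1 - 4 * (z j ^+ 2 + \sum_(a <- s) a j ^+ 2))
  <= sign_avg s (fun y => y i * clip (y j)) z.
Proof.
elim: s z => [|a s IH] z /=; first by move=> _; rewrite !big_nil mul0r addr0.
case/andP=> /andP[ai /andP[aj aj2]] as0; rewrite !big_cons.
have h1 := IH (fun j => z j + a j) as0.
have h2 := IH (fun j => z j - a j) as0.
have h3 : 2 * a j * (1 - 4 * (z j ^+ 2 + \sum_(a <- s) a j ^+ 2)) <=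
   sign_avg s (fun y => clip (y j)) (fun j => z j + a j)
   - sign_avg s (fun y => clip (y j)) (fun j => z j - a j).
  elim: (s) z {IH h1 h2 as0} => [|b s' IH] z /=.
    by rewrite big_nil addr0; apply: clip_central_diff.
  have := IH (fun j => z j + b j); have := IH (fun j => z j - b j); rewrite big_cons /=.
  (* The Lipschitz bound with zero increment shows that the mean depends on the base point only
     through coordinate [j]. *)
  have cong s1 z1 z2 : z1 j = z2 j -> sign_avg s1 (fun y => clip (y j)) z1 =
      sign_avg s1 (fun y => clip (y j)) z2.
    move=> e; have := @sign_avg_mono_lip s1 (@clip R) j z1 z2 (@clip_mono_lip R).
    by rewrite -e lexx subrr => /(_ isT); case/andP; lra.
  rewrite (cong _ (fun j => z j + a j + b j) (fun j => z j + b j + a j)); last by ring.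
  rewrite (cong _ (fun j => z j + a j - b j) (fun j => z j - b j + a j)); last by ring.
  rewrite (cong _ (fun j => z j - a j + b j) (fun j => z j + b j - a j)); last by ring.
  rewrite (cong _ (fun j => z j - a j - b j) (fun j => z j - b j - a j)); last by ring.
  by lra.
move: h1 h2 h3.
set F1 := sign_avg s _ (fun j => z j + a j); set F2 := sign_avg s _ (fun j => z j - a j).
set K1 := sign_avg s _ (fun j => z j + a j); set K2 := sign_avg s _ (fun j => z j - a j).
set S := \sum_(_ <- _) _ * _; set S2 := \sum_(_ <- _) _ => h1 h2 h3.
have S0 : 0 <= S.
  rewrite /S; elim: (s) as0 => [|b s' IH']; first by rewrite big_nil.
  by move=> /= /andP[/andP[b1 /andP[b2 _]] /IH' h]; rewrite big_cons addr_ge0 // mulr_ge0.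
have h4 : a i * (2 * a j * (1 - 4 * (z j ^+ 2 + S2))) <= a i * (F1 - F2) by apply: ler_wpM2l.
have h5 : 0 <= a i * a j * a j ^+ 2 by rewrite !mulr_ge0 // sqr_ge0.
by nra.
Qed.
End SignAverage.

(** * Quadratic forms and Gram matrices *)

Section QuadraticForm.
Variables (R : realType) (T : finType).
Implicit Types (B C : T -> T -> R) (x y h : T -> R) (s : seq (T -> R)).

Definition qform B x : R := \sum_i \sum_j B i j * (x i * x j).

Definition mxdot B C : R := \sum_i \sum_j B i j * C i j.

Definition gram s i j : R := \sum_(a <- s) a i * a j.

Definition basis_vec i : T -> R := fun j => (j == i)%:R.

Lemma sum_cst (c : R) : \sum_(i : T) c = c * #|T|%:R.
Proof. by rewrite sumr_const mulr_natr. Qed.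

Lemma sum_coord i (F : T -> R) : \sum_j F j * (j == i)%:R = F i.
Proof.
rewrite (bigD1 i) //= eqxx mulr1 big1 ?addr0 // => j /negPf ->.
by rewrite mulr0.
Qed.

Lemma eq_qform B x y : x =1 y -> qform B x = qform B y.
Proof. by move=> e; apply: eq_bigr => i _; apply: eq_bigr => j _; rewrite !e. Qed.

Lemma qformD_coord B i (c : R) h : (forall i j, B i j = B j i) ->
  qform B (fun j => h j + c * (j == i)%:R) =
  qform B h + 2 * c * (\sum_j B i j * h j) + c ^+ 2 * B i i.
Proof.
move=> Bsym; rewrite /qform.
have e k j : B k j * ((h k + c * (k == i)%:R) * (h j + c * (j == i)%:R)) =
  B k j * (h k * h j) + (c * (B k j * h k)) * (j == i)%:R + (c * (B k j * h j)) * (k == i)%:R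
   + (c ^+ 2 * B k j) * (j == i)%:R * (k == i)%:R by ring.
under eq_bigr => k _.
  under eq_bigr do rewrite e.
  rewrite !big_split /= sum_coord -!mulr_suml -!mulr_sumr sum_coord.
  over.
rewrite !big_split /= -mulr_sumr !sum_coord.
have -> : \sum_k B k i * h k = \sum_j B i j * h j by apply: eq_bigr => k _; rewrite Bsym.
by ring.
Qed.

(** A form with zero diagonal is affine in each single coordinate, so the coordinates can be pushed
    one by one to an end of [-1, 1] without decreasing it. *)
Lemma qform_max_sign B x : (forall i j, B i j = B j i) -> (forall i, B i i = 0) ->
  (forall i, -1 <= x i <= 1) ->
  exists2 y : T -> R, (forall i, y i = 1 \/ y i = -1) & qform B x <= qform B y.
Proof.
move=> Bsym B0 x1.
have [y [y1 y2 y3]] : exists y : T -> R, [/\ forall i, i \in enum T -> y i = 1 \/ y i = -1,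
    forall i, -1 <= y i <= 1 & qform B x <= qform B y].
  elim: (enum T) => [|i r [y [y1 y2 y3]]]; first by exists x.
  pose b := \sum_j B i j * y j.
  pose c := if 0 <= b then 1 - y i else - 1 - y i.
  exists (fun j => y j + c * (j == i)%:R); split.
  - move=> j; rewrite inE; have [-> _|ji /= /y1] := eqVneq j i.
      by rewrite /c; case: ifP => _; [left|right]; rewrite mulr1; ring.
    by rewrite mulr0 addr0.
  - move=> j; have [-> |ji] := eqVneq j i; last by rewrite mulr0 addr0.
    by rewrite mulr1 /c; case: ifP => _; apply/andP; split; lra.
  - apply: le_trans y3 _; rewrite qformD_coord // B0 mulr0 addr0 lerDl -/b.
    have /andP[l u] := y2 i.
    by rewrite /c; case: (leP 0 b) => hb; nra.
by exists y => // i; apply: y1; rewrite mem_enum.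
Qed.

Lemma mxdotZr B C (c : R) : mxdot B (fun i j => c * C i j) = c * mxdot B C.
Proof.
rewrite /mxdot mulr_sumr; apply: eq_bigr => i _; rewrite mulr_sumr.
by apply: eq_bigr => j _; ring.
Qed.

Lemma eq_mxdot B C D : (forall i j, B i j * C i j = B i j * D i j) -> mxdot B C = mxdot B D.
Proof. by move=> e; apply: eq_bigr => i _; apply: eq_bigr => j _. Qed.

Lemma mxdot_cst (c : R) : mxdot (fun _ _ => 1) (fun _ _ => c) = c * (#|T|%:R) ^+ 2.
Proof.
rewrite /mxdot; under eq_bigr do rewrite mul1r sum_cst.
by rewrite sum_cst expr2 mulrA.
Qed.

Lemma qform_row_eq0 B i j : (forall i j, B i j = B j i) -> (forall h, 0 <= qform B h) ->
  B i i = 0 -> B i j = 0.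
Proof.
move=> Bsym Bpsd Bi.
have E (c : R) : 0 <= B j j + 2 * c * B i j.
  have := Bpsd (fun k => (basis_vec j k) + c * (k == i)%:R).
  rewrite qformD_coord // Bi mulr0 addr0 /basis_vec (sum_coord j (B i)).
  have -> : qform B (basis_vec j) = B j j.
    rewrite /qform /basis_vec; under eq_bigr => k _.
      under eq_bigr do rewrite mulrA; rewrite sum_coord.
      over.
    by rewrite sum_coord.
  by [].
have [//|b] := eqVneq (B i j) 0.
(* This shift makes the quantity in [E] equal to -1. *)
have := E (- (B j j + 1) / (2 * B i j)).
have -> : 2 * (- (B j j + 1) / (2 * B i j)) * B i j = - (B j j + 1) by field.
lra.
Qed.

Lemma qform_rank1 (a : T -> R) h :
  qform (fun i j => a i * a j) h = (\sum_i a i * h i) ^+ 2.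
Proof.
rewrite expr2 mulr_suml; apply: eq_bigr => i _; rewrite mulr_sumr.
by apply: eq_bigr => j _; ring.
Qed.

(** Cholesky elimination: subtracting a rank one form clears the row of a nonzero diagonal entry.
    The Schur complement stays positive semidefinite, its value at [h] being the minimum of the form
    of [B] over shifts of [h] along that coordinate. *)
Lemma psd_gram B : (forall i j, B i j = B j i) -> (forall h, 0 <= qform B h) ->
  exists s, forall i j, B i j = gram s i j.
Proof.
have [m] := ubnP #|[set i | B i i != 0]|; elim: m B => // m IH B.
rewrite ltnS => Bm Bsym Bpsd.
have [i0 Bi0|B0] := pickP (fun i => B i i != 0); last first.
  exists [::] => i j; rewrite /gram big_nil; apply: qform_row_eq0 => //.
  by have /negbFE/eqP := B0 i.
have Bgt : 0 < B i0 i0.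
  rewrite lt_def Bi0 /=; have := Bpsd (fun k => 0 + 1 * (k == i0)%:R).
  rewrite qformD_coord //.
  have -> : qform B (fun=> 0) = 0.
    by rewrite /qform big1 // => i _; rewrite big1 // => j _; rewrite !mulr0.
  by rewrite big1 ?expr1n ?mul1r ?mulr0 ?addr0 ?add0r // => j _; rewrite mulr0.
pose a i := B i0 i / Num.sqrt (B i0 i0).
have aa i j : a i * a j = B i0 i * B i0 j / B i0 i0.
  have sq : Num.sqrt (B i0 i0) ^+ 2 = B i0 i0 by rewrite sqr_sqrtr // ltW.
  rewrite /a -[in RHS]sq; field.
  by rewrite sqrtr_eq0 -ltNge.
pose C i j := B i j - a i * a j.
have [||h|s Cs] := IH C.
- apply: leq_trans Bm; apply: proper_card; apply/properP; split.
    apply/subsetP => i; rewrite !inE; apply: contraNN => /eqP Bi.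
    rewrite /C aa Bi Bsym (qform_row_eq0 i0 Bsym Bpsd Bi); apply/eqP; ring.
  exists i0; rewrite !inE ?Bi0 // negbK /C aa; apply/eqP; field; exact: Bi0.
- by move=> i j; rewrite /C Bsym; ring.
- pose b := \sum_j B i0 j * h j.
  have -> : qform C h = qform (fun i j => B i j) h - qform (fun i j => a i * a j) h.
    rewrite /qform -sumrB; apply: eq_bigr => i _; rewrite -sumrB; apply: eq_bigr => j _.
    by rewrite /C; ring.
  rewrite qform_rank1.
  have -> : \sum_i a i * h i = b / Num.sqrt (B i0 i0).
    by rewrite /b mulr_suml; apply: eq_bigr => i _; rewrite /a; ring.
  rewrite expr_div_n (sqr_sqrtr (ltW Bgt)).
  have := Bpsd (fun j => h j + (- b / B i0 i0) * (j == i0)%:R).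
  rewrite qformD_coord // -/b.
  have -> : qform B h + 2 * (- b / B i0 i0) * b + (- b / B i0 i0) ^+ 2 * B i0 i0 =
    qform B h - b ^+ 2 / B i0 i0 by field; exact: Bi0.
  by [].
- exists (a :: s) => i j; rewrite /gram big_cons.
  by have := Cs i j; rewrite /gram /C => <-; ring.
Qed.
End QuadraticForm.

(** * Rounding Gram matrices *)

Section SubGaussian.
Variable R : realType.
Implicit Types x c mu : R.

Lemma sqr_le_expR x : 0 <= x -> x ^+ 2 <= 2 * expR x.
Proof.
move=> x0; have := @expR_ge1Dxn R x 1 x0.
have -> : 2`!%:R = 2 :> R by [].
by move=> h; lra.
Qed.

Lemma sinh_le (y : R) : 0 <= y -> y <= 1 / 2 -> 0 <= expR y - expR (- y) <= 3 * y.
Proof.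
move=> y0 y1.
have uv : expR y * expR (- y) = 1 by rewrite -expRD subrr expR0.
have hu := @expR_ge1Dx R y; have hv := @expR_ge1Dx R (- y).
have u0 := expR_gt0 y.
have v1 : expR (- y) <= 1 by rewrite -expR0 ler_expR; lra.
have u1 : expR y * (1 - y) <= 1 by rewrite -uv ler_pM2l //; lra.
by apply/andP; split; nra.
Qed.

(** For |x| >= 1 one has |x| <= 2 x^2; for |x| < 1, cosh x = 1 + 2 sinh(x/2)^2 and [sinh_le]
    suffices. *)
Lemma cosh_le x : (expR x + expR (- x)) / 2 <= expR (2 * x ^+ 2).
Proof.
have [x1|x1] := leP 1 (x ^+ 2).
  have h1 : expR x <= expR (2 * x ^+ 2) by rewrite ler_expR; nra.
  have h2 : expR (- x) <= expR (2 * x ^+ 2) by rewrite ler_expR; nra.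
  lra.
have uv : expR (x / 2) * expR (- (x / 2)) = 1 by rewrite -expRD subrr expR0.
have eu : expR x = expR (x / 2) ^+ 2 by rewrite expr2 -expRD; congr expR; field.
have ev : expR (- x) = expR (- (x / 2)) ^+ 2 by rewrite expr2 -expRD; congr expR; field.
have d2 : (expR (x / 2) - expR (- (x / 2))) ^+ 2 <= 9 * (x / 2) ^+ 2.
  have [x0|x0] := leP 0 x.
    have /andP[] : 0 <= expR (x / 2) - expR (- (x / 2)) <= 3 * (x / 2) by apply: sinh_le; nra.
    nra.
  have /andP[] : 0 <= expR (- (x / 2)) - expR (- - (x / 2)) <= 3 * (- (x / 2)).
    by apply: sinh_le; nra.
  by rewrite opprK; nra.
have := @expR_ge1Dx R (2 * x ^+ 2).
by rewrite eu ev; nra.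
Qed.

(** A Chernoff estimate with free rate [mu]: for y >= 1 the squared excess is at most 2 e^y, and e^y
    <= e^(-mu) e^((mu+1) y). The two exponentials serve the two signs of [x]. *)
Lemma clip_tail x mu : 0 <= mu ->
  (x - clip x) ^+ 2 <= 2 * expR (- mu) * (expR ((mu + 1) * x) + expR (- ((mu + 1) * x))).
Proof.
move=> mu0.
have key y : 1 <= y -> (y - 1) ^+ 2 <= 2 * expR (- mu) * expR ((mu + 1) * y).
  move=> y1; rewrite -mulrA -expRD.
  have h1 : y ^+ 2 <= 2 * expR y by apply: sqr_le_expR; lra.
  have h2 : expR y <= expR (- mu + (mu + 1) * y) by rewrite ler_expR; nra.
  by nra.
have p1 := expR_gt0 (- mu); have p2 := expR_gt0 ((mu + 1) * x).
have p3 := expR_gt0 (- ((mu + 1) * x)).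
have q1 : 0 <= expR (- mu) * expR ((mu + 1) * x) by rewrite mulr_ge0 // ltW.
have q2 : 0 <= expR (- mu) * expR (- ((mu + 1) * x)) by rewrite mulr_ge0 // ltW.
rewrite /clip; case: (leP x (-1)) => x1; last case: (leP 1 x) => x2.
- have := key (- x); rewrite mulrN => /(_ ltac:(lra)); nra.
- have := key x x2; nra.
- rewrite subrr expr0n /=; nra.
Qed.

Lemma sign_avg_expR (J : Type) (s : seq (J -> R)) i c z :
  sign_avg s (fun y => expR (c * y i)) z
  <= expR (c * z i) * expR (2 * c ^+ 2 * \sum_(a <- s) a i ^+ 2).
Proof.
elim: s z => [|a s IH] z /=; first by rewrite big_nil mulr0 expR0 mulr1.
have h1 := IH (fun j => z j + a j); have h2 := IH (fun j => z j - a j).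
rewrite big_cons mulrDr expRD mulrA.
set K := expR (2 * c ^+ 2 * \sum_(_ <- _) _) in h1 h2 *.
have K0 : 0 < K by apply: expR_gt0.
apply: (@le_trans _ _ (expR (c * z i) * ((expR (c * a i) + expR (- (c * a i))) / 2) * K)).
  have e1 : expR (c * (z i + a i)) = expR (c * z i) * expR (c * a i) by rewrite mulrDr expRD.
  have e2 : expR (c * (z i - a i)) = expR (c * z i) * expR (- (c * a i)).
    by rewrite mulrDr mulrN expRD.
  rewrite e1 in h1; rewrite e2 in h2; lra.
rewrite ler_pM2r // ler_pM2l ?expR_gt0 //.
by apply: le_trans (cosh_le _) _; rewrite exprMn mulrA.
Qed.

(** The scaling [L ^+ 2 = 4 * (mu + 1)] turns the sub-Gaussian exponent into (mu + 1) / 2, so half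
    of the decay rate [mu] survives. *)
Lemma sign_avg_clip_tail (J : Type) (s : seq (J -> R)) i mu (L : R) :
  0 <= mu -> 0 < L -> L ^+ 2 = 4 * (mu + 1) -> \sum_(a <- s) a i ^+ 2 <= 1 ->
  sign_avg s (fun y => (y i / L - clip (y i / L)) ^+ 2) (fun=> 0)
  <= 4 * expR (- mu + (mu + 1) / 2).
Proof.
move=> mu0 L0 L2 si.
pose c := (mu + 1) / L.
have c2 : 2 * c ^+ 2 = (mu + 1) / 2.
  by rewrite /c expr_div_n L2; field; lra.
apply: (@le_trans _ _ (sign_avg s
  (fun y => 2 * expR (- mu) * (expR (c * y i) + expR (- c * y i))) (fun=> 0))).
  apply: le_sign_avg => y.
  have := clip_tail (y i / L) mu0.
  have -> : (mu + 1) * (y i / L) = c * y i by rewrite /c; ring.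
  by rewrite mulNr.
rewrite sign_avgZ sign_avgD.
have h1 := @sign_avg_expR J s i c (fun=> 0); have h2 := @sign_avg_expR J s i (- c) (fun=> 0).
rewrite mulr0 expR0 mul1r in h1; rewrite mulr0 expR0 mul1r sqrrN in h2.
have h3 : expR (2 * c ^+ 2 * \sum_(a <- s) a i ^+ 2) <= expR ((mu + 1) / 2).
  by rewrite ler_expR c2; nra.
have p1 := expR_gt0 (- mu); rewrite expRD; nra.
Qed.
End SubGaussian.

Section GramRounding.
Variables (R : realType) (T : finType) (B : T -> T -> R).
Hypothesis B1 : forall i j, -1 <= B i j <= 1.
Let n : R := #|T|%:R.

(** Random sign sums of the vectors in [s], divided by [L] and clipped, have correlations within
    [err] of the Gram entries over [La], and some outcome has form at least the average. Undoing the
    scaling costs the factor [La], of order ln n. *)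
Lemma mxdot_gram_le (O : R) s : (2 <= #|T|)%N ->
  (forall x, (forall i, -1 <= x i <= 1) -> qform B x <= O) ->
  (forall i, gram s i i <= 1) ->
  mxdot B (gram s) <= (24 * ln n + 4) * (O + 8) + n.
Proof.
move=> n2 BO s1.
have n2R : 2 <= n by rewrite /n ler_nat.
have n0 : 0 < n by lra.
(* This rate makes [tau] at most 8 / n^3, so the tails cost at most 8 after weighting by n and
   summing over n^2 entries. *)
pose mu := 6 * ln n.
have mu0 : 0 <= mu by rewrite mulr_ge0 // ln_ge0 //; lra.
pose La := 4 * (mu + 1).
have La0 : 0 < La by rewrite /La; lra.
pose L := Num.sqrt La.
have L2 : L ^+ 2 = La by rewrite sqr_sqrtr // ltW.
have L0 : 0 < L by rewrite sqrtr_gt0.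
have diag i : \sum_(a <- s) a i ^+ 2 <= 1.
  by have := s1 i; rewrite /gram; under eq_bigr do rewrite -expr2.
pose tau := 4 * expR (- mu + (mu + 1) / 2).
have tau_le : n ^+ 3 * tau <= 8.
  have e1 : expR (mu / 2) = n ^+ 3.
    rewrite (_ : mu / 2 = 3%:R * ln n); last by rewrite /mu; field.
    by rewrite expRM_natl lnK // posrE.
  have e2 : expR (- mu + (mu + 1) / 2) * n ^+ 3 = expR (1 / 2).
    by rewrite -e1 -expRD; congr expR; field.
  have e3 : expR (1 / 2 : R) <= 2.
    have h := @expR_ge1Dx R (- (1 / 2)); rewrite expRN in h.
    have p := expR_gt0 (1 / 2 : R).
    have := mulVf (lt0r_neq0 p); nra.
  rewrite /tau; lra.
pose X (z : T -> R) i := clip (z i / L).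
pose E F := sign_avg s F (fun=> 0).
(* [clip_prod_err] with [l = n]: the tails get weight n, the second moments, at most 1 / [La],
   weight 1 / n. *)
pose err := n * tau + 1 / (n * La).
have moment i j : E (fun z => z i / L * (z j / L)) = gram s i j / La.
  rewrite /E (@eq_sign_avg _ _ s _ (fun z => La^-1 * (z i * z j))); last first.
    by move=> z; rewrite -L2; field; rewrite gt_eqF.
  by rewrite sign_avgZ sign_avg_moment2 mulr0 add0r mulrC.
have tl i : E (fun z => (z i / L - X z i) ^+ 2) <= tau by apply: sign_avg_clip_tail.
have errE i j : E (fun z => n / 2 * ((z i / L - X z i) ^+ 2 + (z j / L - X z j) ^+ 2)
     + (z i / L * (z i / L) + z j / L * (z j / L)) / (2 * n)) <= err.
  rewrite /E sign_avgD sign_avgZ sign_avgD.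
  rewrite (@eq_sign_avg _ _ s (fun y => (y i / L * (y i / L) + y j / L * (y j / L)) / (2 * n))
     (fun y => (2 * n)^-1 * (y i / L * (y i / L) + y j / L * (y j / L)))); last first.
    by move=> y; rewrite mulrC.
  rewrite sign_avgZ sign_avgD -/(E _) -/(E _).
  rewrite -[X in _ + _ * (X + _)]/(E _) -[X in _ + _ * (_ + X)]/(E _) !moment.
  apply: lerD.
    have := tl i; have := tl j; rewrite /E => h1 h2; nra.
  have -> : 1 / (n * La) = (2 * n)^-1 * (2 / La) by field; lra.
  rewrite ler_pM2l ?invr_gt0; last lra.
  have := s1 i; have := s1 j => h1 h2.
  by rewrite -mulrDl ler_pM2r ?invr_gt0 //; lra.
have close i j : gram s i j / La - E (fun z => X z i * X z j) <= err /\
    - (gram s i j / La - E (fun z => X z i * X z j)) <= err.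
  rewrite -moment; split.
    have h : E (fun z => z i / L * (z j / L) + - 1 * (X z i * X z j)) <= err.
      apply: le_trans (errE i j); apply: le_sign_avg => z.
      by rewrite mulN1r -!expr2; case: (clip_prod_err (z i / L) (z j / L) n0).
    by move: h; rewrite /E sign_avgD sign_avgZ; lra.
  have h : E (fun z => - 1 * (z i / L * (z j / L)) + (X z i * X z j)) <= err.
    apply: le_trans (errE i j); apply: le_sign_avg => z.
    rewrite mulN1r -!expr2; case: (clip_prod_err (z i / L) (z j / L) n0) => _; rewrite /X; lra.
  by move: h; rewrite /E sign_avgD sign_avgZ; lra.
have EO : mxdot B (fun i j => E (fun z => X z i * X z j)) <= O.
  have -> : mxdot B (fun i j => E (fun z => X z i * X z j)) = E (fun z => qform B (X z)).
    rewrite /E /qform sign_avg_sum; apply: eq_bigr => i _.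
    by rewrite sign_avg_sum; apply: eq_bigr => j _; rewrite sign_avgZ.
  have [z hz _] := sign_avg_attained s (fun z => qform B (X z)) (fun=> 0).
  by apply: le_trans hz _; apply: BO => i; apply: clip_itv.
have h : mxdot B (fun i j => La^-1 * gram s i j) <=
   mxdot B (fun i j => E (fun z => X z i * X z j)) + mxdot (fun _ _ : T => 1) (fun _ _ : T => err).
  rewrite /mxdot -big_split; apply: ler_sum => i _; rewrite -big_split; apply: ler_sum => j _ /=.
  have [c1 c2] := close i j; have /andP[b1 b2] := B1 i j.
  rewrite (mulrC La^-1); set D := gram s i j / La in c1 c2 *.
  set e := E _ in c1 c2 *.
  have q1 : 0 <= (1 - B i j) * (err + (D - e)) by apply: mulr_ge0; lra.
  have q2 : 0 <= (1 + B i j) * (err - (D - e)) by apply: mulr_ge0; lra.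
  lra.
rewrite mxdotZr mxdot_cst -/n in h.
have h2 : La^-1 * mxdot B (gram s) <= O + 8 + n / La.
  have e1 : err * n ^+ 2 = n ^+ 3 * tau + n / La by rewrite /err; field; lra.
  lra.
have -> : (24 * ln n + 4) * (O + 8) + n = La * (O + 8 + n / La).
  by rewrite /La /mu; field; rewrite /La /mu in La0; lra.
by rewrite -ler_pdivrMl.
Qed.
End GramRounding.

(** * Semidefinite duality *)

Section Duality.
Variables (R : realType) (T : finType) (B : T -> T -> R).
Hypothesis B1 : forall i j, -1 <= B i j <= 1.
Hypothesis Bsym : forall i j, B i j = B j i.
Let n : R := #|T|%:R.

Lemma gram_le1 (s : seq (T -> R)) i j : (forall i, gram s i i <= 1) -> -1 <= gram s i j <= 1.
Proof.
move=> s1.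
have h1 : 0 <= \sum_(a <- s) (a i - a j) ^+ 2 by apply: sumr_ge0 => a _; apply: sqr_ge0.
have h2 : 0 <= \sum_(a <- s) (a i + a j) ^+ 2 by apply: sumr_ge0 => a _; apply: sqr_ge0.
have e1 : \sum_(a <- s) (a i - a j) ^+ 2 = gram s i i + gram s j j - 2 * gram s i j.
  rewrite /gram mulr_sumr -big_split -sumrB; apply: eq_bigr => a _ /=; ring.
have e2 : \sum_(a <- s) (a i + a j) ^+ 2 = gram s i i + gram s j j + 2 * gram s i j.
  rewrite /gram mulr_sumr -!big_split; apply: eq_bigr => a _ /=; ring.
have := s1 i; have := s1 j => hj hi; apply/andP; split; lra.
Qed.

Lemma gram_scale (D : T -> R) (s : seq (T -> R)) i j :
  gram [seq (fun i => D i * a i) | a : T -> R <- s] i j = D i * D j * gram s i j.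
Proof. by rewrite /gram big_map mulr_sumr; apply: eq_bigr => a _; ring. Qed.

(* One inequality of SDP duality.  If [X] nearly maximises [<B, X>] over the Gram
   matrices with diagonal at most 1, comparing it with [D (X + t h h^T) D], where
   [D = 1 - t h^2 / 2] restores the diagonal, to first order in [t] shows that
   [w i := \sum_j B i j * X i j], shifted by a constant, is dual feasible. *)
Lemma gram_dual (sig : R) : (0 < #|T|)%N ->
  (forall s, (forall i, gram s i i <= 1) -> mxdot B (gram s) <= sig) ->
  exists2 w : T -> R, forall h, qform B h <= \sum_i w i * h i ^+ 2
    & \sum_i w i <= sig + 2 * n.
Proof.
move=> n0 Bsig.
have n0R : 1 <= n by rewrite /n ler1n.
pose V (v : R) := exists2 s, (forall i : T, gram s i i <= 1) & v = mxdot B (gram s).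
have supV : classical_sets.has_sup V.
  split; last by exists sig => v [s s1 ->]; apply: Bsig.
  by exists (mxdot B (gram [::])), [::] => // i; rewrite /gram big_nil ler01.
(* At this size the second-order error [2 * t ^+ 2 * n ^+ 2] is t / 2; together with the gap [t] of
   the near-maximiser it stays below 2 t, which the shift of [w] by 2 absorbs. *)
pose t := (4 * n ^+ 2)^-1.
have t0 : 0 < t by rewrite invr_gt0; nra.
have tn : t * n ^+ 2 = 1 / 4 by rewrite /t; field; lra.
have t1 : t <= 1 / 4 by rewrite -tn ler_peMr ?(ltW t0) //; nra.
have [_ [s s1 ->] sV] := sup_adherent t0 supV.
pose X := gram s; pose w i := \sum_j B i j * X i j.
have X1 i j : -1 <= X i j <= 1 by apply: gram_le1.
exists (fun i => w i + 2); last first.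
  rewrite big_split /= sum_cst -/n lerD2r; exact: Bsig.
move=> h; pose N := \sum_i h i ^+ 2.
have hN i : h i ^+ 2 <= N.
  by rewrite /N (bigD1 i) //= lerDl sumr_ge0 // => j _; apply: sqr_ge0.
have -> : \sum_i (w i + 2) * h i ^+ 2 = \sum_i w i * h i ^+ 2 + 2 * N.
  by rewrite /N mulr_sumr -big_split; apply: eq_bigr => i _ /=; ring.
have N0 : 0 <= N by apply: sumr_ge0 => i _; apply: sqr_ge0.
have [N00|Nneq] := eqVneq N 0.
  have h0 i : h i = 0.
    by have := hN i; have := sqr_ge0 (h i); rewrite N00 => a b; apply/eqP;
      rewrite -sqrf_eq0; apply/eqP; lra.
  rewrite N00 mulr0 addr0 /qform !big1 // => i _; first by rewrite h0 expr0n mulr0.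
  by rewrite big1 // => j _; rewrite h0 mul0r mulr0.
have Np : 0 < N by rewrite lt_def Nneq.
pose u i := t * h i ^+ 2 / N.
have u0 i : 0 <= u i by rewrite /u divr_ge0 // mulr_ge0 ?sqr_ge0 // ltW.
have ut i : u i <= t by rewrite /u ler_pdivrMr // ler_pM2l.
(* Adding the rank one term raises diagonal entry i by [u i], and (1 - u/2)^2 (1 + u) <= 1. *)
pose D i := 1 - u i / 2.
pose s' := [seq (fun i => D i * a i) | a : T -> R <- (fun i => Num.sqrt (t / N) * h i) :: s].
have gs' i j : gram s' i j = D i * D j * (X i j + t / N * (h i * h j)).
  rewrite /s' gram_scale /gram big_cons -/(gram _ _ _) -/(X i j).
  have e : Num.sqrt (t / N) * h i * (Num.sqrt (t / N) * h j) = t / N * (h i * h j).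
    have := sqr_sqrtr (ltW (divr_gt0 t0 Np)) => q.
    by rewrite -[in RHS]q; ring.
  by rewrite e addrC.
have s'1 i : gram s' i i <= 1.
  rewrite gs'.
  have -> : t / N * (h i * h i) = u i by rewrite /u; ring.
  have /andP[_ x1] := X1 i i.
  have := u0 i; have := ut i; rewrite /D; set v := u i => v1 v0.
  have q : (1 - v / 2) * (1 - v / 2) * (X i i + v) <= (1 - v / 2) * (1 - v / 2) * (1 + v).
    by apply: ler_wpM2l; nra.
  apply: le_trans q _; nra.
have le_sup : mxdot B (gram s') <= sup V.
  by apply: (sup_upper_bound supV); exists s'.
have wu : \sum_i \sum_j B i j * X i j * ((u i + u j) / 2) = \sum_i w i * u i.
  have e i j : B i j * X i j * ((u i + u j) / 2) =
    B i j * X i j * u i / 2 + B i j * X i j * u j / 2 by ring.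
  under eq_bigr do [under eq_bigr do rewrite e; rewrite big_split /=].
  rewrite big_split /= [X in _ + X]exchange_big /= -big_split; apply: eq_bigr => i _ /=.
  rewrite /w mulr_suml -big_split; apply: eq_bigr => j _ /=.
  rewrite (Bsym j i) (_ : X j i = X i j); first by field.
  by apply: eq_bigr => a _; rewrite mulrC.
have low : mxdot B X - \sum_i w i * u i + t / N * qform B h - 2 * t ^+ 2 * n ^+ 2
    <= mxdot B (gram s').
  rewrite -wu /qform mulr_sumr -mxdot_cst /mxdot.
  rewrite -!sumrB -big_split -sumrB; apply: ler_sum => i _.
  rewrite mulr_sumr -!sumrB -big_split -sumrB; apply: ler_sum => j _ /=.
  rewrite gs'; set p := t / N * (h i * h j).
  have -> : t / N * (B i j * (h i * h j)) = B i j * p by rewrite /p; ring.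
  have p1 : p <= t /\ - p <= t.
    have e1 : u i + u j - 2 * p = t / N * (h i - h j) ^+ 2 by rewrite /u /p; ring.
    have e2 : u i + u j + 2 * p = t / N * (h i + h j) ^+ 2 by rewrite /u /p; ring.
    have q1 : 0 <= t / N * (h i - h j) ^+ 2 by rewrite mulr_ge0 ?sqr_ge0 // divr_ge0 // ltW.
    have q2 : 0 <= t / N * (h i + h j) ^+ 2 by rewrite mulr_ge0 ?sqr_ge0 // divr_ge0 // ltW.
    have := ut i; have := ut j => a b; split; lra.
  have /andP[x0 x1] := X1 i j; have /andP[b0 b1] := B1 i j.
  have := ut i; have := ut j; have := u0 i; have := u0 j.
  rewrite /D; set a := u i; set b := u j; set c := B i j in b0 b1 *; set x := X i j in x0 x1 *.
  move=> hb ha hb1 ha1.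
  have cx1 : -1 <= c * x <= 1 by apply/andP; split; nra.
  have cp1 : - t <= c * p <= t by case: p1 => ? ?; apply/andP; split; nra.
  have E : c * ((1 - a / 2) * (1 - b / 2) * (x + p)) =
    c * x - c * x * ((a + b) / 2) + c * p + (c * x) * (a * b / 4)
     + (c * p) * (a * b / 4 - (a + b) / 2) by field.
  rewrite E.
  have ab : 0 <= a * b <= t ^+ 2 by apply/andP; split; nra.
  move: cx1 cp1 ab => /andP[m1 m2] /andP[m3 m4] /andP[m5 m6].
  have r1 : - (t ^+ 2 / 4) <= (c * x) * (a * b / 4) by nra.
  have r2 : - (t * t) <= (c * p) * (a * b / 4 - (a + b) / 2).
    set y := a * b / 4 - (a + b) / 2.
    have y1 : - t <= y <= 0 by rewrite /y; apply/andP; split; nra.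
    move: y1 => /andP[y1 y2]; nra.
  nra.
have e : \sum_i w i * u i = t / N * \sum_i w i * h i ^+ 2.
  by rewrite mulr_sumr; apply: eq_bigr => i _; rewrite /u; ring.
rewrite e in low.
have f : t / N * (qform B h - \sum_i w i * h i ^+ 2) <= t / N * (2 * N).
  have -> : t / N * (2 * N) = 2 * t by field.
  have z : 2 * t ^+ 2 * n ^+ 2 = t / 2.
    by rewrite (_ : _ * _ = 2 * t * (t * n ^+ 2)); [rewrite tn; field | ring].
  rewrite -/X in sV; lra.
rewrite ler_pM2l ?divr_gt0 // in f; lra.
Qed.
End Duality.

(** * The discrepancy matrix *)

Lemma natr_bin2 (R : realType) k : 2 * 'C(k, 2)%:R = k%:R * (k%:R - 1) :> R.
Proof.
elim: k => [|k IH]; first by rewrite mul0r mulr0.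
by rewrite binS bin1 natrD mulrDr IH -natr1; ring.
Qed.

Section Discrepancy.
Variables (R : realType) (T : finType) (G : sgraph T).
Implicit Types (U : {set T}).

Let n : R := #|T|%:R.
Let d : R := avg_degree R G.
Let p : R := density R G.

Definition adjm i j : R := (G i j)%:R.
Definition discm i j : R := if i == j then 0 else adjm i j - p.
Definition indic U i : R := (i \in U)%:R.

Lemma adjm_sym i j : adjm i j = adjm j i.
Proof. by rewrite /adjm adj_sym. Qed.

Lemma adjm_ge0 i j : 0 <= adjm i j.
Proof. exact: ler0n. Qed.

Lemma discm_sym i j : discm i j = discm j i.
Proof. by rewrite /discm eq_sym adjm_sym. Qed.

Lemma discm_diag i : discm i i = 0.
Proof. by rewrite /discm eqxx. Qed.

(** Double counting along (a, b) -> {a, b}: each edge inside [U] has exactly the preimages (a, b)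
    and (b, a), distinct by irreflexivity. *)
Lemma card_arcs_in U :
  #|[set q : T * T | [&& G q.1 q.2, q.1 \in U & q.2 \in U]]| = (2 * edges_in G U)%N.
Proof.
set P := [set q | _]; pose f (q : T * T) := [set q.1; q.2].
have fP : f @: P = [set e in edge_set G | e \subset U].
  apply/setP => e; rewrite !inE; apply/imsetP/andP.
    case=> q; rewrite inE => /and3P[Gq q1 q2] ->; split.
      by apply/imsetP; exists q; rewrite ?inE.
    by rewrite /f subUset !sub1set q1.
  case=> /imsetP[q]; rewrite inE => Gq ->; rewrite subUset !sub1set => /andP[q1 q2].
  by exists q; rewrite // inE Gq q1.
rewrite -sum1_card (partition_big_imset f) /= fP mulnC -sum_nat_const.
apply: eq_bigr => e; rewrite -fP => /imsetP[[a b]]; rewrite inE /= => /and3P[Gab aU bU] ->.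
have ab : a != b by apply: contraTneq Gab => ->; rewrite adj_irrefl.
rewrite sum1dep_card (_ : [set x | _] = [set (a, b); (b, a)]).
  by rewrite cards2 xpair_eqE (negPf ab).
apply/setP => -[x y]; rewrite !inE /f /= !xpair_eqE; apply/idP/idP.
  case/andP=> /and3P[Gxy _ _] /eqP/setP h.
  have xy : x != y by apply: contraTneq Gxy => ->; rewrite adj_irrefl.
  have hx : x \in [set a; b] by rewrite -h !inE eqxx.
  have hy : y \in [set a; b] by rewrite -h !inE eqxx orbT.
  by move: hx hy xy; rewrite !inE => /orP[]/eqP-> /orP[]/eqP->; rewrite ?eqxx ?orbT.
case/orP => /andP[/eqP -> /eqP ->]; first by rewrite Gab aU bU eqxx.
by rewrite adj_sym Gab aU bU /= setUC.
Qed.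

Lemma qform_adjm_indic U : qform adjm (indic U) = 2 * (edges_in G U)%:R.
Proof.
rewrite -[2]/(2%:R) -natrM -card_arcs_in -sum1_card natr_sum big_mkcond /=.
rewrite /qform pair_big /=; apply: eq_bigr => -[i j] _ /=.
rewrite inE /= /adjm /indic.
by case: (G i j); case: (i \in U); case: (j \in U); rewrite /= ?mulr0 ?mul0r ?mulr1 ?mulr0.
Qed.

Lemma sum_indic U : \sum_i indic U i = #|U|%:R.
Proof.
rewrite -sum1_card natr_sum [RHS]big_mkcond; apply: eq_bigr => i _.
by rewrite /indic; case: (i \in U).
Qed.

Lemma qform_discm x :
  qform discm x = qform adjm x - p * ((\sum_i x i) ^+ 2 - \sum_i x i ^+ 2).
Proof.
rewrite expr2 mulr_suml -sumrB mulr_sumr -sumrB; apply: eq_bigr => i _.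
have -> : x i ^+ 2 = \sum_j (x i * x j) * (j == i)%:R by rewrite sum_coord expr2.
rewrite mulr_sumr -sumrB mulr_sumr -sumrB; apply: eq_bigr => j _.
rewrite /discm eq_sym; case: eqP => [->|_]; last by rewrite mulr0; ring.
by rewrite /adjm adj_irrefl mulr1 mulr0n; ring.
Qed.

Lemma qform_discm_indic U : qform discm (indic U) = 2 * disc R G U.
Proof.
rewrite qform_discm qform_adjm_indic sum_indic.
have -> : \sum_i indic U i ^+ 2 = #|U|%:R.
  rewrite -sum_indic; apply: eq_bigr => i _.
  by rewrite /indic; case: (i \in U); rewrite ?expr1n ?expr0n.
have := natr_bin2 R #|U|; rewrite /disc -/p => h.
have -> : 2 * ((edges_in G U)%:R - p * 'C(#|U|, 2)%:R) =
   2 * (edges_in G U)%:R - p * (2 * 'C(#|U|, 2)%:R) by ring.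
by rewrite h; ring.
Qed.

Lemma edges_in_setT : edges_in G [set: T] = #|edge_set G|.
Proof. by apply: eq_card => e; rewrite inE subsetT andbT. Qed.

Lemma disc_le_pos_disc U : disc R G U <= pos_disc R G.
Proof.
rewrite /pos_disc (bigD1 U) //=.
by rewrite le_max lexx.
Qed.

Hypothesis n2 : (2 <= #|T|)%N.

Let n2R : 2 <= n. Proof. by rewrite /n ler_nat. Qed.

Lemma nd_edges : n * d = 2 * #|edge_set G|%:R.
Proof. by rewrite mulrC /d /avg_degree divfK // pnatr_eq0 -lt0n; apply: ltnW. Qed.

Lemma density_avg_degree : p * (n - 1) = d.
Proof.
have h := natr_bin2 R #|T|; rewrite -/n in h.
rewrite /p /density /d /avg_degree -/n.
have -> : 'C(#|T|, 2)%:R = n * (n - 1) / 2 :> R by rewrite -h; field.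
move: n2R; move: n => N N2; by field; apply/andP; split; lra.
Qed.

Lemma qform_discm1 : qform discm (fun=> 1) = 0.
Proof.
rewrite (_ : qform _ _ = qform discm (indic [set: T])); last first.
  by apply: eq_qform => i; rewrite /indic inE.
rewrite qform_discm_indic /disc edges_in_setT cardsT /density.
by rewrite divfK ?subrr ?mulr0 // pnatr_eq0 -lt0n bin_gt0.
Qed.

(* The parallelogram identity for the two indicators [1_U], [1_(~U)]: their sum
   has zero form, their difference is the sign vector. *)
Lemma qform_discm_le x : (forall i, -1 <= x i <= 1) -> qform discm x <= 8 * pos_disc R G.
Proof.
move=> x1; have [y y1 h] := qform_max_sign discm_sym discm_diag x1.
apply: le_trans h _.
pose U := [set i | y i == 1].
have e : qform discm y + qform discm (fun=> 1) =
    2 * qform discm (indic U) + 2 * qform discm (indic (~: U)).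
  rewrite /qform !mulr_sumr -!big_split; apply: eq_bigr => i _ /=.
  rewrite !mulr_sumr -!big_split; apply: eq_bigr => j _ /=.
  have neq : (-1 : R) == 1 = false by apply/eqP; lra.
  rewrite /indic /U !inE.
  by case: (y1 i) => ->; case: (y1 j) => ->; rewrite ?eqxx ?neq /=; ring.
rewrite qform_discm1 addr0 !qform_discm_indic in e.
rewrite e; have := disc_le_pos_disc U; have := disc_le_pos_disc (~: U); lra.
Qed.

Lemma density_ge0 : 0 <= p.
Proof. by rewrite /p /density divr_ge0. Qed.

Lemma density_le1 : p <= 1.
Proof.
have c0 : 0 < 'C(#|T|, 2)%:R :> R by rewrite ltr0n bin_gt0.
rewrite /p /density ler_pdivrMr // mul1r ler_nat -(card_draws T 2).
apply: subset_leq_card; apply/subsetP => f /imsetP[q]; rewrite inE => Gq ->.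
by rewrite inE cards2; case: (eqVneq q.1 q.2) Gq => [->|_ _] //; rewrite adj_irrefl.
Qed.

Lemma discm_itv i j : -1 <= discm i j <= 1.
Proof.
have p0 := density_ge0; have p1 := density_le1.
rewrite /discm /adjm; case: eqP => _; first by apply/andP; split; lra.
by case: (G i j) => /=; apply/andP; split; lra.
Qed.
End Discrepancy.

(** * Sparse graphs *)

Section Sparse.
Variables (R : realType) (T : finType) (G : sgraph T).
Hypothesis n4 : (4 <= #|T|)%N.
Let n : R := #|T|%:R.
Let d : R := avg_degree R G.
Let p : R := density R G.
Let A i j : R := adjm R G i j.

Let n2 : (2 <= #|T|)%N. Proof. exact: leq_trans n4. Qed.
Let n4R : 4 <= n. Proof. by rewrite /n ler_nat. Qed.

Definition degree i : R := \sum_j A i j.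

Lemma sum_degree : \sum_i degree i = n * d.
Proof.
rewrite nd_edges // -edges_in_setT -qform_adjm_indic.
by apply: eq_bigr => i _; apply: eq_bigr => j _; rewrite /indic !inE mulr1 mulr1.
Qed.

Lemma density_n_le : p * n <= 4 / 3 * d.
Proof.
have := density_avg_degree R G n2; rewrite -/p -/n -/d => h.
have p0 := density_ge0 R G; rewrite -/p in p0; have := n4R; nra.
Qed.

Lemma degree_ge0 i : 0 <= degree i.
Proof. by apply: sumr_ge0 => j _; apply: adjm_ge0. Qed.

Definition low i : R := (degree i <= 8 * d)%R%:R.

Lemma low01 i : low i = 0 \/ low i = 1.
Proof. by rewrite /low; case: (_ <= _); [right|left]. Qed.

Lemma sum_low : 0 < d -> 7 / 8 * n <= \sum_i low i.
Proof.
move=> d0.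
have h : \sum_i (1 - low i) * (8 * d) <= n * d.
  rewrite -sum_degree; apply: ler_sum => i _; have := degree_ge0 i.
  by rewrite /low; case: (leP (degree i) (8 * d)) => /=; lra.
rewrite -mulr_suml sumrB sum_cst mul1r -/n in h; nra.
Qed.

(** With [x] equal to 1/4 on the low vertices and 1 elsewhere, every arc not inside the low set
    keeps weight at least 1/4, in total at least 0.225 n d. By Markov the sum of [x] is at most
    11/32 n, so the density term costs at most 0.158 n d. *)
Lemma pos_disc_few_low : 1 <= d -> qform A low <= n * d / 10 ->
  n * d / 160 <= pos_disc R G.
Proof.
move=> d1 few; have n4' := n4R; have d0 : 0 < d by lra.
pose x i := 1 - 3 / 4 * low i.
have x1 i : 1 / 4 <= x i <= 1 by rewrite /x; case: (low01 i) => ->; apply/andP; split; lra.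
have hx : qform (discm R G) x <= 8 * pos_disc R G.
  by apply: qform_discm_le => // i; have /andP[] := x1 i => *; apply/andP; split; lra.
have hA : 1 / 4 * (n * d - qform A low) <= qform A x.
  rewrite -sum_degree /qform -sumrB mulr_sumr; apply: ler_sum => i _.
  rewrite /degree -sumrB mulr_sumr; apply: ler_sum => j _.
  have := adjm_ge0 R G i j; rewrite -/(A i j) /x.
  by case: (low01 i) => ->; case: (low01 j) => ->; lra.
have sx : \sum_i x i <= 11 / 32 * n.
  rewrite /x sumrB sum_cst mul1r -mulr_sumr -/n; have := sum_low d0; lra.
have sx0 : 0 <= \sum_i x i.
  by apply: sumr_ge0 => i _; have /andP[] := x1 i => *; lra.
have sx2 : 0 <= \sum_i x i ^+ 2 by apply: sumr_ge0 => i _; apply: sqr_ge0.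
rewrite qform_discm -/p in hx; rewrite -[qform (adjm R G) x]/(qform A x) in hx.
have p0 := density_ge0 R G; rewrite -/p in p0.
have pn := density_n_le.
have s2 : (\sum_i x i) ^+ 2 <= (11 / 32 * n) ^+ 2 by nra.
have : p * ((\sum_i x i) ^+ 2 - \sum_i x i ^+ 2) <= p * (11 / 32 * n) ^+ 2.
  by apply: ler_wpM2l => //; lra.
have : p * (11 / 32 * n) ^+ 2 <= 121 / 768 * (n * d).
  have -> : p * (11 / 32 * n) ^+ 2 = 121 / 1024 * (p * n) * n by field.
  by nra.
have : 0 < n * d by nra.
lra.
Qed.

(** The bound [64 * th ^+ 2 * d <= 1] keeps the variance of the scaled neighbour sums at low
    vertices below 1/8, so clipping loses at most half of the correlation along edges;
    [640 * th * d ^+ 2 <= n] keeps the codegree loss below the gain. *)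
Lemma pos_disc_many_low (th : R) : 1 <= d -> p <= 1 / 4 -> 0 < th ->
  64 * th ^+ 2 * d <= 1 -> 640 * th * d ^+ 2 <= n -> n * d / 10 <= qform A low ->
  th * (n * d) / 960 <= pos_disc R G.
Proof.
move=> d1 p4 th0 th1 th2 many; have n4' := n4R.
have th8 : th <= 1 / 8 by nra.
(* [vec w] holds the contributions of the sign of [w]: coordinate [inl v] is the sign of [v] itself,
   [inr v] the scaled sum over its low neighbours. *)
pose vec (w : T) (k : T + T) : R :=
  match k with inl v => (w == v)%:R | inr v => th * A v w * low w end.
pose s := [seq vec w | w <- enum T].
have sumS (F : (T + T -> R) -> R) : \sum_(a <- s) F a = \sum_w F (vec w).
  by rewrite big_map big_enum.
have A01 i j : A i j = 0 \/ A i j = 1 by rewrite /A /adjm; case: (G i j); [right|left].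
have vec0 w k : 0 <= vec w k.
  case: k => v /=; first exact: ler0n.
  by case: (A01 v w) => ->; case: (low01 w) => ->; lra.
have vec2 w v : vec w (inr v) <= 1 / 2.
  by rewrite /=; case: (A01 v w) => ->; case: (low01 w) => ->; lra.
have s_ge0 k l : all (fun a : T + T -> R => (0 <= a k) && (0 <= a l)) s.
  by rewrite all_map; apply/allP => w _; rewrite inE !vec0.
pose E F := sign_avg s F (fun=> 0).
have cN : forall x : R, clip (- x) = - clip x by exact: clipN.
have Eclip v : E (fun y => clip (y (inr v))) = 0 by apply: sign_avg_odd0.
have Elin v : E (fun y => y (inl v)) = 0 by apply: (sign_avg_odd0 s (f := id)).
have idP : mono_lip (@id R) by move=> x y h; rewrite lexx andbT /=; lra.
have Ell u v : u != v -> E (fun y => y (inl u) * y (inl v)) = 0.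
  move=> uv; rewrite /E sign_avg_moment2 mulr0 add0r sumS big1 // => w _ /=.
  by have [->|_] := eqVneq w u; rewrite ?(negPf uv) ?mulr0 ?mul0r.
have Elr u v : low v = 1 -> th * A u v * low u / 2 <= E (fun y => y (inl u) * clip (y (inr v)))
   <= th * A u v * low u.
  move=> lv.
  have S : \sum_(a <- s) a (inl u) * a (inr v) = th * A u v * low u.
    rewrite sumS /=; under eq_bigr do rewrite mulrC.
    by rewrite sum_coord /A adjm_sym.
  apply/andP; split; last first.
    have /andP[_] := sign_avg_cov (fun=> 0) idP (@clip_mono_lip R) (s_ge0 (inl u) (inr v)).
    by rewrite S -/(E _) -/(E _) -/(E _) Eclip mulr0 subr0.
  have := @sign_avg_clip_lower R _ s (inl u) (inr v) (fun=> 0) _.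
  rewrite mul0r add0r expr0n add0r S => h; apply: le_trans (h _); last first.
    by rewrite all_map; apply/allP => w _; rewrite inE !vec0 vec2.
  have S2 : \sum_(a <- s) a (inr v) ^+ 2 <= th ^+ 2 * (8 * d).
    apply: (@le_trans _ _ (th ^+ 2 * degree v)); last first.
      apply: ler_wpM2l; first exact: sqr_ge0.
      by move: lv; rewrite /low; case: (leP (degree v) _) => //= _ /esym/eqP; rewrite oner_eq0.
    rewrite sumS mulr_sumr; apply: ler_sum => w _ /=.
    by have := sqr_ge0 th; case: (A01 v w) => ->; case: (low01 w) => ->; lra.
  have a0 : 0 <= th * A u v * low u.
    by case: (A01 u v) => ->; case: (low01 u) => ->; lra.
  rewrite ler_wpM2l //; lra.
have Err u v : 0 <= E (fun y => clip (y (inr u)) * clip (y (inr v)))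
   <= th ^+ 2 * \sum_w A u w * A v w * low w.
  have := sign_avg_cov (fun=> 0) (@clip_mono_lip R) (@clip_mono_lip R) (s_ge0 (inr u) (inr v)).
  rewrite -/(E _) -/(E _) -/(E _) Eclip mul0r subr0 sumS => /andP[-> /= h].
  apply: le_trans h _; rewrite mulr_sumr; apply: ler_sum => w _.
  by case: (low01 w) => ->; lra.
pose X (y : T + T -> R) v := low v * ((y (inl v) + clip (y (inr v))) / 2).
pose C u v := \sum_w A u w * A v w * low w.
have C0 u v : 0 <= C u v.
  apply: sumr_ge0 => w _.
  by case: (A01 u w) => ->; case: (A01 v w) => ->; case: (low01 w) => ->; lra.
have p0 := density_ge0 R G; rewrite -/p in p0.
(* Between low vertices, the mixed correlations of an edge give at least th / 4 in all; for a
   non-edge they vanish, leaving only the clipped pair, controlled by the codegree [C u v]. *)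
have entry u v : th / 4 * (1 - 2 * p) * (A u v * (low u * low v)) - p * th ^+ 2 / 4 * C u v
    <= discm R G u v * E (fun y => X y u * X y v).
  have pC : 0 <= p * th ^+ 2 / 4 * C u v.
    by rewrite mulr_ge0 // divr_ge0 // mulr_ge0 // sqr_ge0.
  have [uv|uv] := eqVneq u v.
    subst v.
    have -> : A u u = 0 by rewrite /A /adjm adj_irrefl.
    by rewrite discm_diag !mul0r mulr0; lra.
  have -> : E (fun y => X y u * X y v) = low u * low v / 4 *
     (E (fun y => y (inl u) * clip (y (inr v))) + E (fun y => y (inl v) * clip (y (inr u)))
      + E (fun y => clip (y (inr u)) * clip (y (inr v)))).
    rewrite -[X in X + _]add0r -(Ell _ _ uv) /E -!sign_avgD -sign_avgZ.
    by apply: eq_sign_avg => y; rewrite /X; field.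
  case: (low01 u) => lu; first by rewrite lu !mul0r mulr0; lra.
  case: (low01 v) => lv; first by rewrite lv !mulr0 !mul0r mulr0; lra.
  have := Elr u v lv; have := Elr v u lu; have := Err u v.
  rewrite -/(C u v) lu lv {1 2}/A (adjm_sym R G v u) -/(A u v).
  set e1 := E _; set e2 := E _; set e3 := E _.
  move=> /andP[c1 c2] /andP[c3 c4] /andP[c5 c6].
  rewrite /discm (negPf uv) -/p -/(A u v).
  case: (A01 u v) => Auv; rewrite Auv in c3 c4 c5 c6 *; nra.
have [y hy by1] := sign_avg_attained s (fun y => qform (discm R G) (X y)) (fun=> 0).
have up : qform (discm R G) (X y) <= 8 * pos_disc R G.
  apply: qform_discm_le => // v.
  have := by1 (inl v); rewrite !add0r sumS.
  have -> : \sum_w `|vec w (inl v)| = 1.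
    under eq_bigr do rewrite /= normr_nat -[_%:R]mul1r.
    by rewrite (sum_coord v (fun=> 1)).
  have := clip_itv (y (inr v)); rewrite /X => /andP[c1 c2] /andP[c3 c4].
  by case: (low01 v) => ->; apply/andP; split; lra.
have eE : sign_avg s (fun y => qform (discm R G) (X y)) (fun=> 0) =
    \sum_u \sum_v discm R G u v * E (fun y => X y u * X y v).
  rewrite /qform sign_avg_sum; apply: eq_bigr => u _.
  by rewrite sign_avg_sum; apply: eq_bigr => v _; rewrite sign_avgZ.
have lower : th / 4 * (1 - 2 * p) * qform A low - p * th ^+ 2 / 4 * \sum_u \sum_v C u v
   <= 8 * pos_disc R G.
  apply: le_trans up; apply: le_trans hy; rewrite eE.
  rewrite /qform !mulr_sumr -sumrB; apply: ler_sum => u _.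
  by rewrite !mulr_sumr -sumrB; apply: ler_sum => v _.
(* Paths of length two are counted by their low middle vertex. *)
have sumC : \sum_u \sum_v C u v <= 8 * d * (n * d).
  have -> : \sum_u \sum_v C u v = \sum_w low w * degree w ^+ 2.
    rewrite /C; under eq_bigr do rewrite exchange_big /=.
    rewrite exchange_big /=; apply: eq_bigr => w _.
    rewrite expr2 /degree mulr_suml mulr_sumr; apply: eq_bigr => u _.
    rewrite mulr_sumr mulr_sumr; apply: eq_bigr => v _.
    by rewrite /A (adjm_sym R G u w) (adjm_sym R G v w); ring.
  rewrite -sum_degree mulr_sumr; apply: ler_sum => w _.
  have := degree_ge0 w; rewrite /low; case: (leP (degree w) (8 * d)) => /= h1 h2; nra.
have pn := density_n_le.
have nd0 : 0 < n * d by nra.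
(* The gain is th n d / 80 and the loss th n d / 240; an eighth of the difference is th n d /
   960. *)
have g1 : th / 8 * (n * d / 10) <= th / 4 * (1 - 2 * p) * qform A low.
  have -> : th / 8 * (n * d / 10) = th * (1 / 8 * (n * d / 10)) by ring.
  have -> : th / 4 * (1 - 2 * p) * qform A low = th * ((1 - 2 * p) / 4 * qform A low) by ring.
  rewrite ler_pM2l //; nra.
have g2 : p * th ^+ 2 / 4 * \sum_u \sum_v C u v <= th * (n * d) / 240.
  apply: (@le_trans _ _ (p * th ^+ 2 / 4 * (8 * d * (n * d)))).
    by apply: ler_wpM2l => //; rewrite divr_ge0 // mulr_ge0 // sqr_ge0.
  have -> : p * th ^+ 2 / 4 * (8 * d * (n * d)) = th * d * (2 * th * d * (p * n)) by field.
  have -> : th * (n * d) / 240 = th * d * (n / 240) by ring.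
  apply: ler_wpM2l; first nra.
  have : 2 * th * d * (p * n) <= 2 * th * d * (4 / 3 * d) by apply: ler_wpM2l => //; nra.
  lra.
lra.
Qed.

Lemma pos_disc_sparse (th : R) : 1 <= d -> p <= 1 / 4 -> 0 < th ->
  64 * th ^+ 2 * d <= 1 -> 640 * th * d ^+ 2 <= n ->
  th * (n * d) / 960 <= pos_disc R G.
Proof.
move=> d1 p4 th0 th1 th2; have n4' := n4R.
have [many|few] := leP (n * d / 10) (qform A low); first exact: pos_disc_many_low.
apply: le_trans (pos_disc_few_low d1 (ltW few)).
have th8 : th <= 1 / 8 by nra.
have : 0 < n * d by nra.
nra.
Qed.
End Sparse.

(** * Dense graphs *)

Section Dense.
Variables (R : realType) (T : finType) (G : sgraph T).
Hypothesis n4 : (4 <= #|T|)%N.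
Let n : R := #|T|%:R.
Let p : R := density R G.
Let M i j : R := discm R G i j.

Let n2 : (2 <= #|T|)%N. Proof. exact: leq_trans n4. Qed.

(** Off the diagonal an entry is 1 - p or -p, hence a root of X^2 = (1 - 2p) X + p (1 - p); this
    reduces the cube to an affine function of the entry, with constant term positive for 0 < p <
    1/2. *)
Lemma discm_cube i j :
  M i j ^+ 3 = (1 - 3 * p + 3 * p ^+ 2) * M i j + p * (1 - p) * (1 - 2 * p) * (i != j)%:R.
Proof.
rewrite /M /discm -/p /adjm; case: eqP => _ /=; first by rewrite mulr0n; ring.
by case: (G i j) => /=; rewrite ?mulr0n ?mulr1n; ring.
Qed.

(** Parallelogram identity for the constant vector 1 and the indicator [h] of the complement: the
    form is 0 at 1, at least -p times the squared size of the complement at [h], and at most [O] at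
    their half sum. *)
Lemma qform_discm_co_small (O : R) (U : {set T}) :
  (forall x, (forall i, -1 <= x i <= 1) -> qform M x <= O) ->
  - (2 * p * (#|~: U|%:R) ^+ 2 + 4 * O) <= qform M (indic R U).
Proof.
move=> MO; pose h := indic R (~: U).
have h01 i : h i = 0 \/ h i = 1 by rewrite /h /indic; case: (_ \in _); [right|left].
have q : - (p * (#|~: U|%:R) ^+ 2) <= qform M h.
  rewrite /M qform_discm sum_indic -/p.
  have a0 : 0 <= qform (adjm R G) (indic R (~: U)) by rewrite qform_adjm_indic mulr_ge0.
  have s0 : 0 <= \sum_i (indic R (~: U) i) ^+ 2 by apply: sumr_ge0 => i _; apply: sqr_ge0.
  have p0 := density_ge0 R G; rewrite -/p in p0; nra.
have m : qform M (fun i => (1 + h i) / 2) <= O.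
  by apply: MO => i; case: (h01 i) => ->; apply/andP; split; lra.
have e : 4 * qform M (fun i => (1 + h i) / 2) + qform M (indic R U) =
    2 * qform M (fun=> 1) + 2 * qform M h.
  rewrite /qform !mulr_sumr -!big_split; apply: eq_bigr => i _ /=.
  rewrite !mulr_sumr -!big_split; apply: eq_bigr => j _ /=.
  rewrite /h /indic !inE; by case: (i \in U); case: (j \in U) => /=; rewrite ?mulr0n ?mulr1n; field.
by rewrite qform_discm1 // in e; lra.
Qed.

(** [sg * n] bounds the semidefinite optimum, and vertices with dual weight above [K * sg] are
    discarded; a larger [K] discards fewer of them but weakens the conclusion. *)
Lemma density_dense (O sg K eps : R) : 0 < eps -> 2 * p <= 1 - eps -> 2 <= sg ->
  4 <= K -> 512 <= eps * K ^+ 2 ->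
  (forall x, (forall i, -1 <= x i <= 1) -> qform M x <= O) ->
  256 * O <= p * n ^+ 2 * eps ->
  (forall s, (forall i, gram s i i <= 1) -> mxdot M (gram s) <= sg * n) ->
  p * n ^+ 2 * eps / 32 <= K ^+ 2 * sg ^+ 3 * n.
Proof.
move=> e0 pe sg2 K4 K512 MO On Msg.
have n4R : 4 <= n by rewrite /n ler_nat.
have p0 := density_ge0 R G; rewrite -/p in p0.
have Msym i j : M i j = M j i by apply: discm_sym.
have [w wM sw] := gram_dual (discm_itv R G n2) (discm_sym R G) (leq_trans (ltn0Sn _) n2) Msg.
pose N i j := w i * (j == i)%:R - M i j.
have qN h : qform N h = \sum_i w i * h i ^+ 2 - qform M h.
  rewrite /qform -sumrB; apply: eq_bigr => i _.
  have -> : w i * h i ^+ 2 = \sum_j (w i * (h i * h j)) * (j == i)%:R by rewrite sum_coord; ring.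
  by rewrite -sumrB; apply: eq_bigr => j _; rewrite /N; ring.
have Nsym i j : N i j = N j i.
  by rewrite /N Msym eq_sym; case: eqP => [->|_] //; rewrite !mulr0.
have Npsd h : 0 <= qform N h by rewrite qN subr_ge0; apply: wM.
have Ndiag i : N i i = w i by rewrite /N eqxx mulr1 /M discm_diag subr0.
have w0 i : 0 <= w i.
  have := wM (basis_vec R i); rewrite -[X in X <= _]addr0.
  rewrite (_ : qform _ _ = 0); last first.
    rewrite /qform big1 // => k _; rewrite big1 // => j _; rewrite /basis_vec.
    have [->|_] := eqVneq k i; last by rewrite mul0r mulr0.
    by have [->|_] := eqVneq j i; rewrite ?discm_diag ?mul0r ?mulr0.
  rewrite (_ : \sum_j _ = w i); first lra.
  rewrite -[RHS](sum_coord i w); apply: eq_bigr => j _; rewrite /basis_vec.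
  by case: (j == i); rewrite ?expr1n ?expr0n.
have [s0 Ns0] := psd_gram Nsym Npsd.
pose c := K * sg.
have c0 : 0 < c by rewrite /c; nra.
pose U := [set i | w i <= c].
(* Markov: the weights sum to at most sg n + 2 n <= 2 sg n. *)
have cardU : #|~: U|%:R <= 2 * n / K.
  have h : \sum_i indic R (~: U) i * c <= 2 * sg * n.
    apply: (@le_trans _ _ (\sum_i w i)); last by apply: le_trans sw _; rewrite -/n; nra.
    apply: ler_sum => i _; have := w0 i; rewrite /indic !inE.
    by case: (leP (w i) c) => /=; rewrite ?mulr0n ?mulr1n; lra.
  rewrite -mulr_suml sum_indic /c in h.
  rewrite ler_pdivlMr; last lra.
  by move: h; set k := _%:R; nra.
(* Schur's product theorem in Gram form: products of pairs of vectors represent the entrywise square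
   of [N], here cut down to [U] and scaled. *)
pose s1 := [seq (fun i => indic R U i / c * (a i * b i)) | a : T -> R <- s0, b : T -> R <- s0].
have gs1 i j : gram s1 i j = (indic R U i * indic R U j) / c ^+ 2 * N i j ^+ 2.
  rewrite Ns0 (expr2 (gram s0 i j)) /s1 /gram big_allpairs_dep mulr_suml mulr_sumr.
  apply: eq_bigr => a _.
  rewrite mulr_sumr mulr_sumr; apply: eq_bigr => b _ /=.
  by field; rewrite gt_eqF.
have s11 i : gram s1 i i <= 1.
  rewrite gs1 Ndiag /indic inE; case: (leP (w i) c) => h /=; last by rewrite !mul0r ler01.
  rewrite mulr1 mul1r mulrC -expr_div_n -[1](expr1n _ 2) ler_pXn2r ?nnegrE //.
  - by rewrite ler_pdivrMr // mul1r.
  - by rewrite divr_ge0 // ltW.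
have := Msg _ s11.
(* Off the diagonal [N] is the negative of [M], and on it [M] vanishes, so the pairing is a sum of
   cubes of [M]. *)
rewrite (@eq_mxdot _ _ _ _
  (fun i j => (c ^+ 2)^-1 * (M i j ^+ 2 * (indic R U i * indic R U j)))); last first.
  move=> i j; rewrite gs1 /N; have [->|ji] := eqVneq j i; first by rewrite /M discm_diag !mul0r.
  by rewrite mulr0 sub0r; field; rewrite gt_eqF.
rewrite mxdotZr -ler_pdivlMl ?invr_gt0 ?exprn_gt0 // invrK.
have -> : mxdot M (fun i j => M i j ^+ 2 * (indic R U i * indic R U j)) =
   (1 - 3 * p + 3 * p ^+ 2) * qform M (indic R U)
    + p * (1 - p) * (1 - 2 * p) * (#|U|%:R ^+ 2 - #|U|%:R).
  have -> : #|U|%:R ^+ 2 - #|U|%:R =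
     \sum_i \sum_j (i != j)%:R * (indic R U i * indic R U j) :> R.
    rewrite -sum_indic expr2 mulr_suml -sumrB; apply: eq_bigr => i _.
    rewrite mulr_sumr.
    have -> : indic R U i = \sum_j (indic R U i * indic R U j) * (j == i)%:R.
      by rewrite sum_coord /indic; case: (i \in U); rewrite ?mulr1 ?mulr0.
    rewrite -sumrB; apply: eq_bigr => j _; rewrite eq_sym sum_coord.
    by rewrite /indic; case: (i == j); case: (i \in U); case: (j \in U) => /=; ring.
  rewrite /mxdot /qform !mulr_sumr -big_split; apply: eq_bigr => i _ /=.
  rewrite !mulr_sumr -big_split; apply: eq_bigr => j _ /=.
  rewrite mulrA -exprS discm_cube; ring.
have low := qform_discm_co_small U MO.
have kU : #|U|%:R = n - #|~: U|%:R :> R.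
  by rewrite /n -(cardsC U) natrD addrK.
have k0 : 0 <= #|~: U|%:R :> R by [].
move: low cardU kU k0; set k := #|~: U|%:R; set q := qform _ _; move=> low cardU -> k0 main.
have kK : k * K <= 2 * n by move: cardU; rewrite ler_pdivlMr //; lra.
have k2 : k <= n / 2 by nra.
have kk : 128 * k ^+ 2 <= eps * n ^+ 2.
  have K2 : 0 < K ^+ 2 by nra.
  have z1 : k ^+ 2 * K ^+ 2 <= 4 * n ^+ 2.
    have -> : 4 * n ^+ 2 = (2 * n) ^+ 2 by ring.
    by rewrite -exprMn ler_pXn2r ?nnegrE //; nra.
  rewrite -(ler_pM2r K2).
  have z2 : 0 <= (eps * K ^+ 2 - 512) * n ^+ 2 by rewrite mulr_ge0 ?sqr_ge0 //; lra.
  lra.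
have t1 : - (2 * p * k ^+ 2 + 4 * O) <= (1 - 3 * p + 3 * p ^+ 2) * q.
  have O0 : 0 <= O.
    have := MO (fun=> 0); rewrite (_ : qform _ _ = 0); last first.
      by rewrite /qform big1 // => i _; rewrite big1 // => j _; rewrite !mulr0.
    by apply=> i; apply/andP; split; lra.
  have b0 : 0 <= 2 * p * k ^+ 2 + 4 * O by rewrite addr_ge0 // mulr_ge0 ?sqr_ge0 //; lra.
  have c1 : 0 <= 1 - 3 * p + 3 * p ^+ 2 <= 1 by apply/andP; split; nra.
  move: c1 => /andP[c1 c2]; set b := 2 * p * k ^+ 2 + 4 * O in low b0 *; nra.
have t2 : p * eps * n ^+ 2 / 16 <= p * (1 - p) * (1 - 2 * p) * ((n - k) ^+ 2 - (n - k)).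
  have m1 : n ^+ 2 / 8 <= (n - k) ^+ 2 - (n - k) by nra.
  have m2 : eps / 2 <= (1 - p) * (1 - 2 * p) by nra.
  have -> : p * eps * n ^+ 2 / 16 = p * (eps / 2 * (n ^+ 2 / 8)) by field.
  have -> : p * (1 - p) * (1 - 2 * p) * ((n - k) ^+ 2 - (n - k)) =
    p * ((1 - p) * (1 - 2 * p) * ((n - k) ^+ 2 - (n - k))) by ring.
  by apply: ler_wpM2l => //; apply: ler_pM => //; nra.
have t3 : 2 * p * k ^+ 2 <= p * n ^+ 2 * eps / 64.
  have : p * (128 * k ^+ 2) <= p * (eps * n ^+ 2) by apply: ler_wpM2l.
  lra.
(* In units of p n^2 eps / 64 the main term [t2] is 4, and [k] and [O] cost at most 1 each. *)
have e : c ^+ 2 * (sg * n) = K ^+ 2 * sg ^+ 3 * n by rewrite /c; ring.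
rewrite e in main; lra.
Qed.

(** If the bound failed, rounding would bound the semidefinite optimum by 513 q n, and
    [density_dense] would give q^4 = O(q^3), contradicting the size of [q]. *)
Lemma pos_disc_dense (eps q : R) : 0 < eps -> eps < 1 -> 2 * p <= 1 - eps ->
  1 <= q -> avg_degree R G = q ^+ 4 -> (64 * 64) <= eps * q -> (32 * 513 / eps) ^+ 3 < q ->
  q * n / ln n < pos_disc R G.
Proof.
move=> e0 e1 pe q1 dq eq qbig; rewrite ltNge; apply/negP => small.
have n4R : 4 <= n by rewrite /n ler_nat.
set l := ln n in small.
have l2 : 1 / 2 <= l.
  have x0 : 0 < n^-1 by rewrite invr_gt0; lra.
  have x4 : n^-1 <= 4^-1 by rewrite lef_pV2 ?posrE; lra.
  have := @le_ln1Dx R (n^-1 - 1); rewrite subrKC lnV ?posrE; last lra.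
  by rewrite -/l => /(_ ltac:(lra)); lra.
have l_lt_n : l < n by apply: ln_sublinear; lra.
pose D := q * n / l; pose O := 8 * D.
have Dl : D * l = q * n by rewrite /D divfK // gt_eqF //; lra.
have D0 : 0 <= D by rewrite /D divr_ge0 //; nra.
have MO (x : T -> R) : (forall i, -1 <= x i <= 1) -> qform M x <= O.
  by move=> x1; apply: le_trans (qform_discm_le G n2 x1) _; rewrite /O /D; lra.
(* The 513 is 256 from the term 8 D, 256 from the additive 8 and 1 from the final n, using 24 l + 4
   <= 32 l and l < n. *)
have Msg s : (forall i, gram s i i <= 1) -> mxdot M (gram s) <= 513 * q * n.
  move=> s1; apply: le_trans (mxdot_gram_le (discm_itv R G n2) n2 MO s1) _.
  rewrite -/n -/l.
  have : (24 * l + 4) * (O + 8) <= 32 * l * (O + 8) by apply: ler_wpM2r; rewrite /O; lra.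
  have -> : 32 * l * (O + 8) = 256 * (D * l) + 256 * l by rewrite /O; ring.
  by rewrite Dl; nra.
have p0 := density_ge0 R G; rewrite -/p in p0.
have pn : n * q ^+ 4 <= p * n ^+ 2.
  have := density_avg_degree R G n2; rewrite dq -/n -/p => <-.
  have -> : n * (p * (n - 1)) = p * n ^+ 2 - p * n by ring.
  nra.
have On : 256 * O <= p * n ^+ 2 * eps.
  have D2 : D <= 2 * (q * n) by rewrite -Dl; nra.
  have q2 : 1 <= q ^+ 2 by nra.
  have h1 : (64 * 64) * 1 <= eps * q * q ^+ 2 by apply: ler_pM => //; lra.
  have h2 : n * q ^+ 4 * eps <= p * n ^+ 2 * eps by apply: ler_wpM2r => //; lra.
  have h3 : q * n * ((64 * 64) * 1) <= q * n * (eps * q * q ^+ 2) by apply: ler_wpM2l => //; nra.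
  have -> : 256 * O = 256 * 8 * D by rewrite /O; ring.
  have e4 : q * n * (eps * q * q ^+ 2) = n * q ^+ 4 * eps by ring.
  lra.
have K4 : 4 <= 32 / eps by rewrite ler_pdivlMr //; lra.
have K512 : 512 <= eps * (32 / eps) ^+ 2.
  have -> : eps * (32 / eps) ^+ 2 = 32 * (32 / eps) by field; rewrite gt_eqF.
  have : 32 <= 32 / eps by rewrite ler_pdivlMr //; lra.
  lra.
have sg2 : 2 <= 513 * q by lra.
have main := density_dense e0 pe sg2 K4 K512 MO On Msg.
have h1 : n * q ^+ 4 * eps / 32 <= (32 / eps) ^+ 2 * (513 * q) ^+ 3 * n.
  by apply: le_trans main; rewrite ler_pM2r ?invr_gt0 // ler_pM2r.
move: h1 qbig; move: (513 : R) => a h1 qbig.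
have qn : 0 < n * q ^+ 3 by rewrite mulr_gt0 ?exprn_gt0 //; lra.
have h2 : n * q ^+ 3 * q <= n * q ^+ 3 * (32 * a / eps) ^+ 3.
  have -> : n * q ^+ 3 * q = 32 / eps * (n * q ^+ 4 * eps / 32) by field; rewrite gt_eqF.
  have -> : n * q ^+ 3 * (32 * a / eps) ^+ 3 = 32 / eps * ((32 / eps) ^+ 2 * (a * q) ^+ 3 * n).
    by field; rewrite gt_eqF.
  by rewrite ler_pM2l // divr_gt0.
rewrite ler_pM2l // in h2; lra.
Qed.
End Dense.

(** * The three ranges of the average degree *)

Lemma powR_ratioX (R : realType) (x : R) k m : 0 <= x -> (0 < m)%N ->
  (x `^ (k%:R / m%:R)) ^+ m = x ^+ k.
Proof.
move=> x0 m0; rewrite -powR_mulrn ?powR_ge0 // -powRrM divfK ?powR_mulrn //.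
by rewrite pnatr_eq0 -lt0n.
Qed.

(** Since y >= 8^(m+1), y^m = y^(m+1) / y is at most (y/8)^(m+1). This turns d <= n^(m/(m+1)) into d
    <= n/8. *)
Lemma le_eighth_of_powers (R : realType) (x y : R) m : 0 <= x -> 8 ^+ m.+1 <= y ->
  x ^+ m.+1 <= y ^+ m -> x <= y / 8.
Proof.
move=> x0 y8 xy.
have y0 : 0 <= y by apply: le_trans y8; rewrite exprn_ge0.
have y80 : 0 <= y / 8 by rewrite divr_ge0.
rewrite -(@ler_pXn2r _ m.+1) ?nnegrE //; apply: le_trans xy _.
by rewrite expr_div_n ler_pdivlMr ?exprn_gt0 // (exprS y m) mulrC ler_wpM2r ?exprn_ge0.
Qed.

Section Regimes.
Variables (R : realType) (T : finType) (G : sgraph T).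
Hypothesis n4 : (4 <= #|T|)%N.
Let n : R := #|T|%:R.
Let d : R := avg_degree R G.
Let p : R := density R G.
Hypothesis d1 : 1 <= d.

Let n2 : (2 <= #|T|)%N. Proof. exact: leq_trans n4. Qed.
Let d0 : 0 < d. Proof. exact: lt_le_trans d1. Qed.
Let n0 : 0 < n. Proof. by rewrite /n ltr0n; apply: leq_trans n4. Qed.

Lemma density_le_quarter : d <= n / 8 -> p <= 1 / 4.
Proof.
have n4R : 4 <= n by rewrite /n ler_nat.
move=> dn; have := density_avg_degree R G n2; rewrite -/n -/d -/p => dp.
have p0 := density_ge0 R G; rewrite -/p in p0; nra.
Qed.

(** The density divides d by n - 1 rather than n; as eps n >= 1, this uses up only half of the slack
    2 eps. *)
Lemma density_le_half (eps : R) : 1 <= eps * n -> d <= (1 / 2 - eps) * n -> 0 <= eps ->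
  2 * p <= 1 - eps.
Proof.
have n4R : 4 <= n by rewrite /n ler_nat.
move=> en dn e0; have := density_avg_degree R G n2; rewrite -/n -/d -/p => dp.
have n1 : 0 < n - 1 by lra.
rewrite -(ler_pM2r n1) -mulrA dp; lra.
Qed.

(** Taking th = 1 / (640 sqrt d) exhausts the first constraint of [pos_disc_sparse] up to a
    constant; the second becomes d^(3/2) <= n. *)
Lemma pos_disc_regime1 : d <= n / 8 -> d ^+ 3 <= n ^+ 2 ->
  (640 * 960)^-1 * Num.sqrt d * n <= pos_disc R G.
Proof.
move=> dn d3; set r := Num.sqrt d.
have r2 : r ^+ 2 = d by rewrite sqr_sqrtr // ltW.
have r0 : 0 < r by rewrite sqrtr_gt0.
have r3 : r ^+ 3 <= n.
  rewrite -(@ler_pXn2r _ 2) ?nnegrE ?exprn_ge0 ?(ltW r0) ?(ltW n0) //.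
  by rewrite -exprM mulnC exprM r2.
have rn : r != 0 by rewrite gt_eqF.
have -> : (640 * 960)^-1 * r * n = (640 * r)^-1 * (n * d) / 960 by rewrite -r2; field.
apply: pos_disc_sparse => //.
- exact: density_le_quarter.
- by rewrite invr_gt0 mulr_gt0.
- have -> : 64 * (640 * r)^-1 ^+ 2 * avg_degree R G = 64 / 640 ^+ 2 by rewrite -/d -r2; field.
  by rewrite ler_pdivrMr ?exprn_gt0 // mul1r expr2 -natrM ler_nat.
- by have -> : 640 * (640 * r)^-1 * avg_degree R G ^+ 2 = r ^+ 3 by rewrite -/d -r2; field.
Qed.

(** Taking th = n / (640 d^2) makes the second constraint an equality; the first then follows from
    n^2 <= d^3. *)
Lemma pos_disc_regime2 : d <= n / 8 -> n ^+ 2 <= d ^+ 3 ->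
  (640 * 960)^-1 * n ^+ 2 / d <= pos_disc R G.
Proof.
move=> dn d3; have dN0 : d != 0 by rewrite gt_eqF.
have d20 : 0 < d ^+ 2 by rewrite exprn_gt0.
have -> : (640 * 960)^-1 * n ^+ 2 / d = n / (640 * d ^+ 2) * (n * d) / 960 by field.
apply: pos_disc_sparse => //.
- exact: density_le_quarter.
- by rewrite divr_gt0 // mulr_gt0.
- have -> : 64 * (n / (640 * d ^+ 2)) ^+ 2 * avg_degree R G = 64 / 640 ^+ 2 * (n ^+ 2 / d ^+ 3).
    by rewrite -/d; field.
  apply: mulr_ile1.
  + by rewrite divr_ge0 // exprn_ge0.
  + by rewrite divr_ge0 // exprn_ge0 // ltW.
  + by rewrite ler_pdivrMr ?exprn_gt0 // mul1r expr2 -natrM ler_nat.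
  + by rewrite ler_pdivrMr ?mul1r ?exprn_gt0.
- have -> : 640 * (n / (640 * d ^+ 2)) * avg_degree R G ^+ 2 = n by rewrite -/d; field.
  by [].
Qed.
End Regimes.

Theorem theorem1p2 (R : realType) :
  exists2 c : R, 0 < c &
  forall eps : R, 0 < eps -> eps < 1 / 2 ->
  exists2 c1 : R, 0 < c1 &
  exists n0 : nat, forall n : nat, (n0 <= n)%N ->
  forall (T : finType) (G : sgraph T), #|T| = n ->
  let d := avg_degree R G in
  1 <= d ->
  [/\ d <= n%:R `^ (2 / 3) ->
        c * d `^ (1 / 2) * n%:R < pos_disc R G,
      n%:R `^ (2 / 3) <= d -> d <= n%:R `^ (4 / 5) ->
        c * n%:R ^+ 2 / d < pos_disc R G
    & n%:R `^ (4 / 5) <= d -> d <= (1 / 2 - eps) * n%:R ->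
        c1 * d `^ (1 / 4) * n%:R / ln n%:R < pos_disc R G].
Proof.
pose b : R := (640 * 960)^-1.
have b0 : 0 < b by rewrite /b invr_gt0 mulr_gt0.
(* Halving makes the inequalities strict. *)
exists (b / 2); first by rewrite divr_gt0.
(* The dense argument has d^(1/3) to spend where d^(1/4) is claimed, so the constant can be 1 and
   [eps] enters only through the threshold on n. *)
move=> eps e0 e2; exists 1 => //.
pose f := 32 * 513 / eps; pose q0 := f ^+ 3.
have f1 : 32 * 513 <= f by rewrite /f ler_pdivlMr //; lra.
have q0f : f <= q0 by rewrite /q0 exprS ler_peMr ?exprn_ege1 //; lra.
have q05 : q0 <= q0 ^+ 5 by rewrite (exprS q0 4) ler_peMr ?exprn_ege1 //; lra.
(* In the dense range n <= q^5 with q = d^(1/4), so n > q0^5 forces q > q0; the term 8^5 serves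
   [le_eighth_of_powers]. *)
pose Y := q0 ^+ 5 + 8 ^+ 5.
have Y0 : 0 <= Y by rewrite addr_ge0 ?exprn_ge0 //; lra.
exists (Num.bound Y) => n n0 T G Tn d d1.
have nY : Y < n%:R by apply: lt_le_trans (archi_boundP Y0) _; rewrite ler_nat.
have p8 m : 0 <= 8 ^+ m :> R by rewrite exprn_ge0.
have n8 : 8 ^+ 5 <= n%:R :> R.
  by apply: ltW; apply: le_lt_trans nY; rewrite lerDr exprn_ge0 //; lra.
have nq0 : q0 ^+ 5 < n%:R by apply: le_lt_trans nY; rewrite lerDl.
have n83 : 8 ^+ 3 <= n%:R :> R by apply: le_trans n8; rewrite ler_eXn2l // ltr1n.
have n4 : (4 <= #|T|)%N.
  rewrite Tn -(ler_nat R); apply: le_trans n83; by rewrite -natrX ler_nat.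
have n0R : 0 <= n%:R :> R by [].
have d0 : 0 <= d by apply: le_trans d1.
have dX k m : (0 < m)%N -> d <= n%:R `^ (k%:R / m%:R) -> d ^+ m <= n%:R ^+ k.
  by move=> m0 h; rewrite -(@powR_ratioX R n%:R k m) // ler_pXn2r ?nnegrE ?powR_ge0.
have Xd k m : (0 < m)%N -> n%:R `^ (k%:R / m%:R) <= d -> n%:R ^+ k <= d ^+ m.
  by move=> m0 h; rewrite -(@powR_ratioX R n%:R k m) // ler_pXn2r ?nnegrE ?powR_ge0.
have ngt0 : 0 < n%:R :> R by apply: lt_le_trans n83; rewrite exprn_gt0.
have dgt0 : 0 < d by apply: lt_le_trans d1.
clear p8 n0 Y0 nY.
have half (x : R) : 0 < x -> x / 2 < x by lra.
split.
- move=> /(dX 2 3 isT) h.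
  have dn := le_eighth_of_powers d0 n83 h.
  have main := @pos_disc_regime1 R T G n4 d1; rewrite Tn in main.
  apply: lt_le_trans (main dn h); rewrite mul1r powR12_sqrt // -/b -/d.
  have -> : b / 2 * Num.sqrt d * n%:R = (b * Num.sqrt d * n%:R) / 2 by ring.
  by apply: half; rewrite !mulr_gt0 // sqrtr_gt0.
- move=> /(Xd 2 3 isT) h1 /(dX 4 5 isT) h2.
  have dn := le_eighth_of_powers d0 n8 h2.
  have main := @pos_disc_regime2 R T G n4 d1; rewrite Tn in main.
  apply: lt_le_trans (main dn h1); rewrite -/b -/d.
  have -> : b / 2 * n%:R ^+ 2 / d = (b * n%:R ^+ 2 / d) / 2 by ring.
  by apply: half; rewrite divr_gt0 // mulr_gt0 // exprn_gt0.
- move=> /(Xd 4 5 isT) h1 h2; rewrite mul1r.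
  pose q := d `^ (1 / 4).
  have q4 : q ^+ 4 = d by rewrite /q (@powR_ratioX R d 1 4).
  have qp : 0 <= q by apply: powR_ge0.
  have Nq : n%:R <= q ^+ 5.
    by rewrite -(@ler_pXn2r _ 4) ?nnegrE ?exprn_ge0 // -exprM mulnC exprM q4.
  have qbig : q0 < q.
    rewrite ltNge; apply/negP => qq0.
    have q00 : 0 <= q0 by apply: le_trans qq0.
    have : q ^+ 5 <= q0 ^+ 5 by rewrite ler_pXn2r ?nnegrE.
    by apply/negP; rewrite -ltNge; apply: lt_le_trans nq0 Nq.
  have fe : f * eps = 32 * 513 by rewrite /f divfK // gt_eqF.
  have fq : f * eps <= eps * q by rewrite mulrC ler_pM2l //; apply: ltW; apply: le_lt_trans qbig.
  have fn : f * eps <= eps * n%:R.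
    by rewrite mulrC ler_pM2l //; apply: ltW; apply: le_lt_trans nq0; apply: le_trans q05.
  rewrite fe in fq fn.
  rewrite -Tn; apply: (@pos_disc_dense R T G n4 eps q) => //.
  + by lra.
  + by apply: (density_le_half n4); rewrite ?Tn ?(ltW e0) //; lra.
  + by apply: le_trans (ltW qbig); lra.
  + by lra.
Qed.
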